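(* Let $Q\subset\mathbb{R}^2$ be a bounded convex region and $\phi:Q\to\mathbb{R}_{+}$ a nonnegative density with $\int_Q\phi(q)\,dq=1$. For $k$ points $P=(p_1,\dots,p_k)$ in $Q$ define the coverage cost $$H(P)=\sum_{i=1}^k\int_{V_i}\|q-p_i\|^2\phi(q)\,dq,$$ where $V_i=\{q\in Q:\|q-p_i\|^2\le\|q-p_j\|^2\ \forall j\ne i\}$ is the Voronoi cell of $p_i$. Let $P^\ast$ be a minimizer of $H$ over all $k$-point configurations. Superimpose on $Q$ a uniform square grid of side $\varepsilon$, producing cells $C_1,\dots,C_n$ (the nonempty intersections of grid squares with $Q$), with weights $w_i=\int_{C_i}\phi(q)\,dq$ and centers of mass $x_i=\frac{1}{w_i}\int_{C_i}q\,\phi(q)\,dq$. Let $P=(p_1,\dots,p_k)$ be obtained from $X=\{x_1,\dots,x_n\}$ by weighted-$D^2$ sampling: $p_1=x_i$ with probability proportional to $w_i$; then, repeatedly until $k$ points are chosen, the next point is $x_i$ with probability $\frac{w_iD(x_i)^2}{\sum_j w_jD(x_j)^2}$, where $D(x)$ is the distance from $x$ to the nearest already chosen point. Then $$\mathrm{E}[H(P)]\le 8(\ln k+2)H(P^\ast)+16\sqrt{2}(\ln k+2)D\varepsilon+\sum_i J_{C_i|x_i},$$ where $J_{C_i|x_i}=\int_{C_i}\phi(q)\|q-x_i\|^2\,dq$ and $D$ is the maximum distance $\|p^\ast_a-p^\ast_b\|$ between two points of $P^\ast$ whose Voronoi cells are neighbors.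
   Context: $J_{C_i|x_i}$ is the moment of inertia of cell $C_i$ (with density $\phi$) about its center of mass $x_i$. Two points of a configuration are Voronoi neighbors if their Voronoi cells share a boundary. *)

(* Defs.v *)
From HB Require Import structures.
From mathcomp Require Import all_boot all_order all_algebra.
From mathcomp Require Import all_classical all_reals all_analysis.
Set Implicit Arguments. Unset Strict Implicit. Unset Printing Implicit Defensive.
Import Order.TTheory GRing.Theory Num.Theory.
Import numFieldNormedType.Exports.
Local Open Scope classical_set_scope.
Local Open Scope ring_scope.

Section Coverage.
Context {R : realType}.

Definition area := ((@lebesgue_measure R) \x (@lebesgue_measure R))%E.

Definition sqdist (p q : R * R) : R := (p.1 - q.1) ^+ 2 + (p.2 - q.2) ^+ 2.
Definition dist2 (p q : R * R) : R := Num.sqrt (sqdist p q).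

Definition bounded_convex (Q : set (R * R)) : Prop :=
  (exists M : R, forall q, Q q -> `|q.1| <= M /\ `|q.2| <= M) /\
  (forall p q (t : R), Q p -> Q q -> 0 <= t <= 1 ->
     Q ((1 - t) * p.1 + t * q.1, (1 - t) * p.2 + t * q.2)).

Definition voronoi (Q : set (R * R)) (k : nat) (P : 'I_k -> R * R) (i : 'I_k)
  : set (R * R) :=
  [set q | Q q /\ forall j : 'I_k, j != i -> sqdist q (P i) <= sqdist q (P j)].

Definition cost (Q : set (R * R)) (phi : R * R -> R) (k : nat)
  (P : 'I_k -> R * R) : \bar R :=
  (\sum_(i < k) \int[area]_(q in voronoi Q P i) (sqdist q (P i) * phi q)%:E)%E.

(* Voronoi neighbours: the two cells share a boundary, i.e. their
   (convex) intersection contains at least two distinct points (a segment) *)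
Definition voronoi_neighbors (Q : set (R * R)) (k : nat) (P : 'I_k -> R * R)
  (a b : 'I_k) : Prop :=
  exists q1 q2, q1 <> q2 /\ (voronoi Q P a `&` voronoi Q P b) q1 /\
                            (voronoi Q P a `&` voronoi Q P b) q2.

Definition neighbor_diam (Q : set (R * R)) (k : nat) (P : 'I_k -> R * R) : R :=
  \big[Num.max/0]_(a < k) \big[Num.max/0]_(b < k |
      (a != b) && `[< voronoi_neighbors Q P a b >]) dist2 (P a) (P b).

Definition grid_square (a0 b0 eps : R) (ij : int * int) : set (R * R) :=
  [set q | a0 + ij.1%:~R * eps <= q.1 < a0 + (ij.1 + 1)%:~R * eps /\
           b0 + ij.2%:~R * eps <= q.2 < b0 + (ij.2 + 1)%:~R * eps].

Section Grid.
Variables (Q : set (R * R)) (phi : R * R -> R) (a0 b0 eps : R) (n : nat)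
  (idx : 'I_n -> int * int).

Definition cell (t : 'I_n) : set (R * R) := grid_square a0 b0 eps (idx t) `&` Q.
Definition weight (t : 'I_n) : R := Rintegral area (cell t) phi.
Definition centroid (t : 'I_n) : R * R :=
  ((weight t)^-1 * Rintegral area (cell t) (fun q => q.1 * phi q),
   (weight t)^-1 * Rintegral area (cell t) (fun q => q.2 * phi q)).
Definition cell_inertia (t : 'I_n) : \bar R :=
  \int[area]_(q in cell t) (phi q * sqdist q (centroid t))%:E.

Definition nearest_sqdist (chosen : seq 'I_n) (x : R * R) : R :=
  match chosen with
  | [::] => 0
  | c :: cs => foldr (fun c' m => Num.min (sqdist x (centroid c')) m)
                     (sqdist x (centroid c)) cs
  end.

Definition step_prob (chosen : seq 'I_n) (i : 'I_n) : R :=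
  match chosen with
  | [::] => weight i / \sum_(j < n) weight j
  | _ => weight i * nearest_sqdist chosen (centroid i) /
         \sum_(j < n) weight j * nearest_sqdist chosen (centroid j)
  end.

Fixpoint seq_prob_aux (chosen s : seq 'I_n) : R :=
  match s with
  | [::] => 1
  | i :: s' => step_prob chosen i * seq_prob_aux (rcons chosen i) s'
  end.

Definition sample_prob (k : nat) (s : k.-tuple 'I_n) : R := seq_prob_aux [::] s.

Definition expected_cost (k : nat) : \bar R :=
  (\sum_(s : k.-tuple 'I_n)
      (sample_prob s)%:E * cost Q phi (fun m : 'I_k => centroid (tnth s m)))%E.

End Grid.
End Coverage.

(* Main.v *)
Require Import Defs.
From HB Require Import structures.
From mathcomp Require Import all_boot all_order all_algebra.
From mathcomp Require Import all_classical all_reals all_analysis.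
From mathcomp Require Import measurable_realfun ring lra zify.
Set Implicit Arguments. Unset Strict Implicit. Unset Printing Implicit Defensive.
Import Order.TTheory GRing.Theory Num.Theory.
Import numFieldNormedType.Exports.
Local Open Scope classical_set_scope.
Local Open Scope ring_scope.

(** Let L = sqrt 2 * eps be the diagonal of a grid square, H the cost of P*, and w_j, x_j the
    weights and centroids of the grid cells.  A sample of positive probability consists of
    distinct points, so its Voronoi cells overlap in a null set, and sending each grid cell as a
    whole to the sample point nearest to x_j bounds E[H(P)] by the expected discrete cost of the
    x_j plus the sum of the inertias.

    For any partition of the x_j into K clusters of total cost O, the expected discrete cost
    of k draws is at most 5 A O, with A = 1 + H_(k-1) (harmonic number) if K = k, and
    A = 1 + 10 (K - 1) / (9 (k - K)) if K < k.  Clusters with O <= 8 (ln k + 2) / (5 A) (H + 2 L D)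
    are therefore enough.

    If D is not small compared with L, assigning x_j to the best point of P* suffices; the
    factor 5 in place of 8 pays for the grid cells that meet several Voronoi cells.  If D / L is
    small this slack is not enough, but then P* is concentrated, because the graph of Voronoi
    neighbours is connected: one point in d + 1, and one more, come within d D of all of P*; P*
    lies in a disc of radius (k - 1) D / 2; and few grid cells come within a given distance
    of P*.  Depending on k and D / L, one uses as clusters the cells assigned to a dominating
    set with d = 3; all cells together; or the cells near P* one by one, and for the
    others a dominating set with d = 7 or a single centre. *)

(** The allowance for the discretisation, 8 (ln k + 2) 2 L D, is linear in D, whereas the error
    charged to the grid cells is of order L ^ 2; when D is small, L D does not pay for L ^ 2. This
    is why the usual factor 8 for hitting a cluster is sharpened to 5. With k clusters the ratio s =
    8 / 5 becomes available. Young's inequality with weight s bounds the cluster cost by s H + s /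
    (s - 1) L ^ 2 / 4, and the last term fits into 2 s L D exactly when D >= 5 L / 24.

    Below this threshold the gain comes from having fewer clusters than draws: A drops from order ln
    k to a constant, so s may be of order ln k and the affordable error grows with it. The price is
    a larger distance from the cells to the retained centres, and the choice of clusters balances
    the two. *)

Section PlanePoints.
Context {R : realType}.
Implicit Types (p q c : R * R).

Lemma sqdist_ge0 p q : 0 <= sqdist p q.
Proof. by rewrite addr_ge0// sqr_ge0. Qed.

Lemma sqdistC p q : sqdist p q = sqdist q p.
Proof. by rewrite /sqdist; ring. Qed.

Lemma sqdistxx p : sqdist p p = 0.
Proof. by rewrite /sqdist; ring. Qed.

Lemma sqdist_eq0 p q : sqdist p q = 0 -> p = q.
Proof.
move=> /eqP; rewrite paddr_eq0 ?sqr_ge0// !sqrf_eq0 !subr_eq0.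
by case: p q => [p1 p2] [q1 q2] /= /andP[/eqP-> /eqP->].
Qed.

Lemma sqdist_split p q c : sqdist p q <= 2 * sqdist p c + 2 * sqdist c q.
Proof.
rewrite /sqdist -subr_ge0.
rewrite [X in 0 <= X](_ : _ = (p.1 - 2 * c.1 + q.1) ^+ 2 + (p.2 - 2 * c.2 + q.2) ^+ 2).
  by rewrite addr_ge0// sqr_ge0.
by ring.
Qed.

(** Expand [y i - y j] about [c]. The subtracted squares are those of the first moments about [c],
    so dropping them bounds the pair sum for every [c], not only for the centre of mass. *)
Lemma sum_pair_sqdist (I : finType) (P : pred I) (u : I -> R) (y : I -> R * R) c :
  \sum_(i | P i) \sum_(j | P j) u i * u j * sqdist (y i) (y j) =
  2 * (\sum_(i | P i) u i) * (\sum_(i | P i) u i * sqdist (y i) c) -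
  2 * ((\sum_(i | P i) u i * ((y i).1 - c.1)) ^+ 2 +
       (\sum_(i | P i) u i * ((y i).2 - c.2)) ^+ 2).
Proof.
set W := \sum_(i | P i) u i; set S := \sum_(i | P i) u i * sqdist _ _.
set X := \sum_(i | P i) u i * (_ - c.1); set Y := \sum_(i | P i) u i * (_ - c.2).
transitivity (\sum_(i | P i) (u i * sqdist (y i) c * W + u i * S -
   2 * (u i * ((y i).1 - c.1)) * X - 2 * (u i * ((y i).2 - c.2)) * Y)).
  apply: eq_bigr => i _.
  rewrite /W /S /X /Y !mulr_sumr -!sumrN -!big_split/=; apply: eq_bigr => j _.
  by rewrite /sqdist; ring.
rewrite !big_split/= -!mulr_suml !sumrN -!mulr_suml -!mulr_sumr -/X -/Y -/S -/W.
by ring.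
Qed.

End PlanePoints.

(** * Weighted D^2 sampling *)

Section Seeding.
Context {R : realType}.
Variables (Q : set (R * R)) (phi : R * R -> R) (a0 b0 eps : R) (n : nat)
  (idx : 'I_n -> int * int).

Local Notation w := (weight Q phi a0 b0 eps idx).
Local Notation x := (centroid Q phi a0 b0 eps idx).
Local Notation nearest := (nearest_sqdist Q phi a0 b0 eps idx).
Local Notation prob := (step_prob Q phi a0 b0 eps idx).

Hypothesis w_ge0 : forall i, 0 <= w i.

Lemma nearest_le ch c p : c \in ch -> nearest ch p <= sqdist p (x c).
Proof.
case: ch => // a ch; rewrite inE => /orP[/eqP ->|].
  by elim: ch => //= b ch ih; rewrite ge_min ih orbT.
elim: ch => //= b ch ih; rewrite inE => /orP[/eqP ->|/ih h].
  by rewrite ge_min lexx.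
by rewrite ge_min h orbT.
Qed.

Lemma nearest_ex ch p : ch != [::] ->
  exists2 c, c \in ch & nearest ch p = sqdist p (x c).
Proof.
case: ch => // a ch _; elim: ch => [|b ch [c cin e]] /=.
  by exists a; rewrite ?inE.
rewrite minEle; case: ifP => _; first by exists b => //; rewrite !inE eqxx orbT.
by exists c => //; move: cin; rewrite !inE => /orP[->//|->]; rewrite !orbT.
Qed.

Lemma nearest_ge0 ch p : 0 <= nearest ch p.
Proof.
have [->//|/(nearest_ex p) [c _ ->]] := eqVneq ch [::].
exact: sqdist_ge0.
Qed.

Lemma nearest_rcons ch i p : ch != [::] ->
  nearest (rcons ch i) p = Num.min (nearest ch p) (sqdist p (x i)).
Proof.
move=> ch0; apply/eqP; rewrite eq_le le_min -andbA; apply/and3P; split.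
- have [c cin ->] := nearest_ex p ch0.
  by apply: nearest_le; rewrite mem_rcons inE cin orbT.
- by apply: nearest_le; rewrite mem_rcons inE eqxx.
- have [|c + ->] := @nearest_ex (rcons ch i) p; first by case: (ch).
  rewrite mem_rcons inE ge_min => /orP[/eqP ->|/nearest_le ->//].
  by rewrite lexx orbT.
Qed.

Lemma nearest_lip ch p q : ch != [::] ->
  nearest ch p <= 2 * nearest ch q + 2 * sqdist p q.
Proof.
move=> /(nearest_ex q) [c cin ->]; apply: le_trans (nearest_le _ cin) _.
by rewrite addrC sqdist_split.
Qed.

Definition seed_cost (P : pred 'I_n) ch := \sum_(j | P j) w j * nearest ch (x j).

Lemma seed_cost_ge0 P ch : 0 <= seed_cost P ch.
Proof. by apply: sumr_ge0 => j _; rewrite mulr_ge0// nearest_ge0. Qed.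

Lemma seed_cost_rcons P ch i : ch != [::] ->
  seed_cost P (rcons ch i) <= seed_cost P ch.
Proof.
move=> ch0; apply: ler_sum => j _; rewrite ler_wpM2l//.
by rewrite nearest_rcons// ge_min lexx.
Qed.

Lemma step_prob_ge0 ch i : 0 <= prob ch i.
Proof.
case: ch => [|a ch]; first by rewrite divr_ge0// sumr_ge0.
rewrite divr_ge0 ?mulr_ge0 ?nearest_ge0//.
by apply: sumr_ge0 => j _; rewrite mulr_ge0 ?nearest_ge0.
Qed.

(** Not an equality: when all weighted distances vanish, the quotients by 0 are 0 and so is the
    sum. *)
Lemma sum_step_prob_le1 ch : \sum_i prob ch i <= 1.
Proof.
have h (u : R) : u / u <= 1 by have [->|u0] := eqVneq u 0; rewrite ?mul0r ?divff.
by case: ch => [|a ch]; rewrite /step_prob -mulr_suml; exact: h.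
Qed.

(** The expectation unfolded at the next draw, which is where the inductions on [t] condition;
    [seedingE] identifies it with the sum over tuples. *)
Fixpoint seeding (F : seq 'I_n -> R) (t : nat) (ch : seq 'I_n) : R :=
  if t is t'.+1 then \sum_i prob ch i * seeding F t' (rcons ch i) else F ch.

Lemma seedingE F t ch :
  \sum_(s : t.-tuple 'I_n) seq_prob_aux Q phi a0 b0 eps idx ch s * F (ch ++ s)
  = seeding F t ch.
Proof.
elim: t ch => [|t ih] ch.
  rewrite (big_pred1 [tuple]) => [|s]; first by rewrite /= mul1r cats0.
  by apply/esym/eqP; exact: tuple0.
pose h (p : 'I_n * t.-tuple 'I_n) := [tuple of p.1 :: p.2].
rewrite (reindex h); last first.
  exists (fun s : t.+1.-tuple 'I_n => (thead s, [tuple of behead s])) => [[i s] _|s _].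
    by rewrite /h /= theadE; congr pair; apply: val_inj.
  by rewrite /h /= -tuple_eta.
rewrite -(pair_big xpredT xpredT
  (fun i (s : t.-tuple 'I_n) => seq_prob_aux Q phi a0 b0 eps idx ch (i :: s) *
      F (ch ++ (i :: s))))/=.
apply: eq_bigr => i _; rewrite -ih mulr_sumr; apply: eq_bigr => s _.
by rewrite mulrA cat_rcons.
Qed.

Lemma seeding1_le1 t ch : seeding (fun=> 1) t ch <= 1.
Proof.
elim: t ch => //= t ih ch.
apply: le_trans (sum_step_prob_le1 ch); apply: ler_sum => i _.
by rewrite -[leRHS]mulr1 ler_wpM2l ?step_prob_ge0.
Qed.

Section Clusters.
Variables (C : finType) (cl : 'I_n -> C) (ctr : C -> R * R).

Local Notation Phi ch A := (seed_cost (fun j => cl j == A) ch).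
Local Notation mass A := (\sum_(i | cl i == A) w i).

(** The least cost of the cluster with a single centre, in a form that does not name its centre of
    mass. For mass 0 the quotient is 0. *)
Definition spread (A : C) : R :=
  (\sum_(i | cl i == A) \sum_(j | cl j == A) w i * w j * sqdist (x i) (x j)) /
  (2 * mass A).

Definition moment (A : C) (p : R * R) : R :=
  \sum_(i | cl i == A) w i * sqdist p (x i).

Lemma mass_ge0 A : 0 <= mass A. Proof. exact: sumr_ge0. Qed.

Lemma spread_ge0 A : 0 <= spread A.
Proof.
apply: divr_ge0; last by rewrite mulr_ge0// mass_ge0.
apply: sumr_ge0 => i _; apply: sumr_ge0 => j _.
by rewrite mulr_ge0 ?mulr_ge0 ?sqdist_ge0.
Qed.

Lemma spread_le A p : spread A <= moment A p.
Proof.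
rewrite /spread /moment.
have -> : \sum_(i | cl i == A) w i * sqdist p (x i) =
          \sum_(i | cl i == A) w i * sqdist (x i) p.
  by apply: eq_bigr => i _; rewrite sqdistC.
have [W0|W0] := eqVneq (mass A) 0.
  by rewrite W0 mulr0 invr0 mulr0 sumr_ge0// => i _; rewrite mulr_ge0 ?sqdist_ge0.
have Wp : 0 < mass A by rewrite lt_def W0 mass_ge0.
rewrite ler_pdivrMr ?mulr_gt0// (sum_pair_sqdist _ _ _ p) lerBlDr.
by rewrite mulrC lerDl mulr_ge0// addr_ge0 ?sqr_ge0.
Qed.

(** Read as an average: a point of the cluster drawn by weight is a centre of twice the least
    cost. *)
Lemma sum_moment A :
  \sum_(i | cl i == A) w i * moment A (x i) = 2 * mass A * spread A.
Proof.
rewrite /spread; have [W0|W0] := eqVneq (mass A) 0.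
  rewrite W0 mulr0 mul0r big1// => i /eqP ci.
  have := @psumr_eq0P _ _ (fun j => cl j == A) w (fun j _ => w_ge0 j) W0 i.
  by rewrite ci eqxx => ->; rewrite ?mul0r.
rewrite mulrC divfK ?mulf_neq0 ?pnatr_eq0//.
by apply: eq_bigr => i _; rewrite /moment mulr_sumr; apply: eq_bigr => j _; rewrite mulrA.
Qed.

Lemma Phi_rcons_le A ch i : ch != [::] -> Phi (rcons ch i) A <= moment A (x i).
Proof.
move=> ch0; apply: ler_sum => j _; rewrite ler_wpM2l// nearest_rcons//.
by rewrite ge_min sqdistC lexx orbT.
Qed.

(* Pointwise, with [d] the squared distance of the new centre to the old ones,
   [d * min(Phi, N) <= d * O + 4 Phi (N - O) / W]; the case [4 Phi < W d] uses
   [W d <= 2 Phi + 2 N].  Since [N] has mean [2 O], this averages to [5 O Phi]. *)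
Lemma hit_cost A ch : ch != [::] ->
  \sum_(i | cl i == A) w i * nearest ch (x i) * Phi (rcons ch i) A <=
  5 * spread A * Phi ch A.
Proof.
move=> ch0; set O := spread A; set F := Phi ch A; set W := mass A.
have F0 : 0 <= F by exact: seed_cost_ge0.
have O0 : 0 <= O by exact: spread_ge0.
have [W0|W0] := eqVneq W 0.
  rewrite big1; first exact: mulr_ge0 (mulr_ge0 (ler0n _ 5) O0) F0.
  move=> i /eqP ci; have := @psumr_eq0P _ _ (fun j => cl j == A) w (fun j _ => w_ge0 j) W0 i.
  by rewrite ci eqxx => ->; rewrite ?mul0r.
have Wp : 0 < W by rewrite lt_def W0 mass_ge0.
have key i : cl i == A -> w i * nearest ch (x i) * Phi (rcons ch i) A <=
    w i * nearest ch (x i) * O + 4 * F / W * (w i * (moment A (x i) - O)).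
  move=> ci; set d := nearest ch (x i); set N := moment A (x i).
  have d0 : 0 <= d by exact: nearest_ge0.
  have NO : O <= N by exact: spread_le.
  have fF : Phi (rcons ch i) A <= F by exact: seed_cost_rcons.
  have fN : Phi (rcons ch i) A <= N by exact: Phi_rcons_le.
  have Wd : W * d <= 2 * F + 2 * N.
    rewrite /W /F /seed_cost /N /moment !mulr_sumr -big_split/= mulr_suml.
    apply: ler_sum => j _.
    rewrite [leRHS](_ : _ = w j * (2 * nearest ch (x j) + 2 * sqdist (x i) (x j))).
      by rewrite ler_wpM2l// nearest_lip.
    by ring.
  rewrite -mulrA -[X in _ <= X + _]mulrA [X in _ <= _ + X]mulrCA -mulrDr ler_wpM2l//.
  have [h|h] := leP (d * W) (4 * F).
    apply: (@le_trans _ _ (d * N)); first by rewrite ler_wpM2l.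
    have -> : d * N = d * O + d * (N - O) by ring.
    by rewrite lerD2l ler_wpM2r ?subr_ge0// ler_pdivlMr.
  apply: (@le_trans _ _ (d * F)); first by rewrite ler_wpM2l.
  have -> : d * O + 4 * F / W * (N - O) = (d * W * O + 4 * F * (N - O)) / W.
    by field.
  rewrite ler_pdivlMr//.
  have h1 : d * W <= 4 * N by move: Wd h; rewrite [W * d]mulrC; lra.
  have h2 : 4 * F * O <= d * W * O by rewrite ler_wpM2r// ltW.
  have h3 : d * W * F <= 4 * N * F by rewrite ler_wpM2r.
  have -> : d * F * W = d * W * F by ring.
  by lra.
apply: le_trans; first by apply: ler_sum => i ci; exact: key i ci.
rewrite big_split/= -mulr_suml -mulr_sumr.
have -> : \sum_(i | cl i == A) w i * (moment A (x i) - O) = 2 * W * O - W * O.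
  by rewrite -sum_moment mulr_suml -sumrB; apply: eq_bigr => i _; rewrite mulrBr.
by rewrite -[\sum_(_ | _) _]/F le_eqVlt; apply/orP; left; apply/eqP; field.
Qed.

End Clusters.
End Seeding.

(** * Expected cost as the clusters are hit one after another *)

Section SeedingBound.
Context {R : realType}.
Variables (Q : set (R * R)) (phi : R * R -> R) (a0 b0 eps : R) (n : nat)
  (idx : 'I_n -> int * int).

Local Notation w := (weight Q phi a0 b0 eps idx).
Local Notation x := (centroid Q phi a0 b0 eps idx).
Local Notation nearest := (nearest_sqdist Q phi a0 b0 eps idx).
Local Notation prob := (step_prob Q phi a0 b0 eps idx).
Local Notation cost := (seed_cost Q phi a0 b0 eps idx xpredT).
Local Notation V := (seeding Q phi a0 b0 eps idx cost).

Hypothesis w_ge0 : forall i, 0 <= w i.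

(** Multiplied out so as to survive [cost ch = 0]: every summand of the cost is then 0. *)
Lemma step_prob_cost ch i : ch != [::] ->
  prob ch i * cost ch = w i * nearest ch (x i).
Proof.
move=> ch0; have -> : prob ch i = w i * nearest ch (x i) / cost ch.
  by case: ch ch0.
have [c0|c0] := eqVneq (cost ch) 0; last by rewrite divfK.
rewrite c0 mulr0; apply/esym.
apply: (@psumr_eq0P _ _ xpredT (fun j => w j * nearest ch (x j))) => // j _.
by rewrite mulr_ge0 ?nearest_ge0.
Qed.

Lemma seeding_le t ch : ch != [::] -> V t ch <= cost ch.
Proof.
elim: t ch => [//|t ih] ch ch0 /=.
apply: (@le_trans _ _ (\sum_i prob ch i * cost ch)).
  apply: ler_sum => i _; rewrite ler_wpM2l ?step_prob_ge0//.
  apply: le_trans (seed_cost_rcons _ _ _ ch0) => //.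
  by apply: ih; case: (ch).
rewrite -mulr_suml -[leRHS]mul1r ler_wpM2r ?seed_cost_ge0//.
exact: sum_step_prob_le1.
Qed.

Variables (C : finType) (cl : 'I_n -> C).
Local Notation Phi ch A := (seed_cost Q phi a0 b0 eps idx (fun j => cl j == A) ch).
Local Notation spread := (spread Q phi a0 b0 eps idx cl).
(** [U] stands for the clusters not yet hit. What they will cost once hit, [5] times their spread by
    [hit_cost], is booked here in advance, so that hitting one of them does not raise this quantity
    on average. *)
Definition covered ch (U : {set C}) := \sum_(A in ~: U) Phi ch A + 5 * \sum_(A in U) spread A.
Definition uncovered ch (U : {set C}) := \sum_(A in U) Phi ch A.

Lemma cost_split ch (U : {set C}) :
  cost ch = \sum_(A in ~: U) Phi ch A + uncovered ch U.
Proof.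
rewrite /uncovered /seed_cost (partition_big cl xpredT)//= (bigID (mem U))/= addrC.
by congr (_ + _); apply: eq_bigl => A; rewrite ?inE.
Qed.

Lemma uncovered_ge0 ch U : 0 <= uncovered ch U.
Proof. by apply: sumr_ge0 => A _; exact: seed_cost_ge0. Qed.

Lemma sum_spread_ge0 (U : {set C}) : 0 <= \sum_(A in U) spread A.
Proof. by apply: sumr_ge0 => A _; exact: spread_ge0. Qed.

Lemma covered_ge ch U : \sum_(A in ~: U) Phi ch A <= covered ch U.
Proof. by rewrite lerDl mulr_ge0// sum_spread_ge0. Qed.

Lemma sumPhi_ge0 ch U : 0 <= \sum_(A in ~: U) Phi ch A.
Proof. by apply: sumr_ge0 => A _; exact: seed_cost_ge0. Qed.

Lemma covered_ge0 ch U : 0 <= covered ch U.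
Proof. exact: le_trans (sumPhi_ge0 ch U) (covered_ge _ _). Qed.

Definition seeding_bound t u (a b : R) := forall ch, ch != [::] ->
  forall U : {set C}, #|U| = u -> V t ch <= a * covered ch U + b * uncovered ch U.

Lemma sum_sqr_ge (U : {set C}) (f : C -> R) : (0 < #|U|)%N ->
  (\sum_(A in U) f A) ^+ 2 / #|U|%:R <= \sum_(A in U) f A ^+ 2.
Proof.
move=> U0; have u0 : 0 < #|U|%:R :> R by rewrite ltr0n.
set S := \sum_(A in U) f A; pose m := S / #|U|%:R.
have : 0 <= \sum_(A in U) (f A - m) ^+ 2 by apply: sumr_ge0 => A _; exact: sqr_ge0.
rewrite (eq_bigr (fun A => f A ^+ 2 - 2 * m * f A + m ^+ 2)); last first.
  by move=> A _; ring.
rewrite !big_split/= sumrN -mulr_sumr -/S sumr_const -mulr_natr.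
rewrite [X in _ - X + _](_ : _ = 2 * (m ^+ 2 * #|U|%:R)); last first.
  by rewrite /m; field; rewrite lt0r_neq0.
rewrite [S ^+ 2 / _](_ : _ = m ^+ 2 * #|U|%:R); last first.
  by rewrite /m; field; rewrite lt0r_neq0.
by lra.
Qed.

(** Condition on the cluster of the next draw: a hit in [U] leaves [u] clusters and the constants
    [ah], [bh]; a wasted draw keeps [U] and uses [aw], [bw]. Multiplying by [cost ch] clears the
    probabilities. A hit on [A] leaves [Uc - Phi A] uncovered, and Cauchy-Schwarz on the sum of
    [Phi A ^ 2] produces the factor [u / (u + 1)]. *)
Lemma seeding_step t u ah bh aw bw : 0 <= ah -> 0 <= bh -> 0 <= aw -> 0 <= bw ->
  seeding_bound t u ah bh -> seeding_bound t u.+1 aw bw ->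
  forall ch, ch != [::] -> forall U : {set C}, #|U| = u.+1 ->
  V t.+1 ch * cost ch <=
  uncovered ch U * (ah * covered ch U + bh * (u%:R / u.+1%:R) * uncovered ch U) +
  (\sum_(A in ~: U) Phi ch A) * (aw * covered ch U + bw * uncovered ch U).
Proof.
move=> ah0 bh0 aw0 bw0 hh hw ch ch0 U cU.
set H' := covered ch U; set Uc := uncovered ch U.
have rc i : rcons ch i != [::] by case: (ch).
have hit A : A \in U ->
    \sum_(i | cl i == A) w i * nearest ch (x i) * V t (rcons ch i) <=
    Phi ch A * (ah * H' + bh * (Uc - Phi ch A)).
  move=> AU.
  have card : #|U :\ A| = u by move: (cardsD1 A U); rewrite AU cU => -[].
  have UcE ch' : uncovered ch' U = Phi ch' A + uncovered ch' (U :\ A).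
    by rewrite /uncovered (big_setD1 A).
  have HE : \sum_(B in U) spread B = spread A + \sum_(B in U :\ A) spread B.
    by rewrite (big_setD1 A).
  have HcE ch' : \sum_(B in ~: (U :\ A)) Phi ch' B = Phi ch' A + \sum_(B in ~: U) Phi ch' B.
    rewrite (big_setD1 A) ?inE ?eqxx//=; congr (_ + _); apply: eq_bigl => B.
    by rewrite !inE negb_and negbK; case: eqVneq => //= ->; rewrite AU.
  apply: (@le_trans _ _ (\sum_(i | cl i == A) (w i * nearest ch (x i) *
     (ah * (\sum_(B in ~: U) Phi ch B + 5 * \sum_(B in U :\ A) spread B) + bh * (Uc - Phi ch A))
      + ah * (w i * nearest ch (x i) * Phi (rcons ch i) A)))).
    apply: ler_sum => i /eqP ci.
    set y := ah * _ + _; set z := Phi (rcons ch i) A; set v := w i * _.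
    rewrite [leRHS](_ : _ = v * (y + ah * z)); last by ring.
    rewrite ler_wpM2l ?mulr_ge0 ?nearest_ge0//.
    apply: le_trans (hh _ (rc i) _ card) _.
    rewrite /covered HcE.
    have h1 : \sum_(B in ~: U) Phi (rcons ch i) B <= \sum_(B in ~: U) Phi ch B.
      by apply: ler_sum => B _; exact: seed_cost_rcons.
    have h2 : uncovered (rcons ch i) (U :\ A) <= Uc - Phi ch A.
      rewrite /Uc UcE addrC addKr; apply: ler_sum => B _; exact: seed_cost_rcons.
    have := ler_wpM2l ah0 h1; have := ler_wpM2l bh0 h2.
    by rewrite /y -/z; lra.
  have PhiE : \sum_(i | cl i == A) w i * nearest ch (x i) = Phi ch A by [].
  rewrite big_split/= -mulr_suml -mulr_sumr PhiE.
  apply: (@le_trans _ _ (Phi ch A * (ah * (\sum_(B in ~: U) Phi ch B + 5 * \sum_(B in U :\ A) spread B) +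
        bh * (Uc - Phi ch A)) + ah * (5 * spread A * Phi ch A))).
    by rewrite lerD2l ler_wpM2l//; exact: hit_cost.
  rewrite /H' /covered HE.
  rewrite le_eqVlt; apply/orP; left; apply/eqP; ring.
have waste A : A \notin U ->
    \sum_(i | cl i == A) w i * nearest ch (x i) * V t (rcons ch i) <=
    Phi ch A * (aw * H' + bw * Uc).
  move=> AU; rewrite /seed_cost mulr_suml.
  apply: ler_sum => i _; rewrite ler_wpM2l ?mulr_ge0 ?nearest_ge0//.
  apply: le_trans (hw _ (rc i) _ cU) _.
  rewrite lerD ?ler_wpM2l// ?lerD2r; apply: ler_sum => B _; exact: seed_cost_rcons.
rewrite /= mulr_suml (eq_bigr (fun i => w i * nearest ch (x i) * V t (rcons ch i))); last first.
  by move=> i _; rewrite mulrAC step_prob_cost.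
rewrite (partition_big cl xpredT)//= (bigID (mem U))/=.
apply: lerD; last first.
  rewrite [leRHS]mulr_suml [leRHS](eq_bigl (fun A => A \notin U)); last first.
    by move=> A; rewrite inE.
  by apply: ler_sum => A; exact: waste.
apply: le_trans; first by apply: ler_sum => A AU; exact: hit A AU.
rewrite (eq_bigr (fun A => Phi ch A * (ah * H' + bh * Uc) - bh * Phi ch A ^+ 2)); last first.
  by move=> A _; ring.
rewrite big_split/= sumrN -mulr_suml -mulr_sumr -/(uncovered ch U) -/Uc.
have := @sum_sqr_ge U (fun A => Phi ch A); rewrite cU => /(_ isT).
rewrite -/(uncovered ch U) -/Uc => sq.
have := ler_wpM2l bh0 sq.
have -> : u%:R / u.+1%:R = 1 - u.+1%:R^-1 :> R.
  by rewrite -natr1; field; rewrite natr1 pnatr_eq0.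
set q := bh * \sum_(_ in _) _.
have -> : bh * (Uc ^+ 2 / u.+1%:R) = bh * u.+1%:R^-1 * Uc * Uc by ring.
set r := bh * _ * Uc * Uc.
have -> : Uc * (ah * H' + bh * (1 - u.+1%:R^-1) * Uc) = Uc * (ah * H' + bh * Uc) - r.
  by rewrite /r; ring.
by lra.
Qed.

Definition harm (t : nat) : R := \sum_(i < t) i.+1%:R^-1.

Lemma harmS t : harm t.+1 = harm t + t.+1%:R^-1.
Proof. by rewrite /harm big_ord_recr. Qed.

Lemma harm_ge0 t : 0 <= harm t.
Proof. by apply: sumr_ge0 => i _; rewrite invr_ge0. Qed.

Lemma harm_le t : harm t <= t%:R.
Proof.
elim: t => [|t ih]; first by rewrite /harm big_ord0.
by rewrite harmS -[leRHS]natr1; apply: lerD => //; rewrite invf_le1 ?ler1n ?ltr0n.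
Qed.

Lemma seeding_bound_start u : seeding_bound 0 u 1 1.
Proof.
move=> ch ch0 U _; rewrite !mul1r /= (cost_split _ U) lerD2r; exact: covered_ge.
Qed.

Lemma seeding_boundW t u a a' b : a <= a' -> seeding_bound t u a b -> seeding_bound t u a' b.
Proof.
move=> aa h ch ch0 U cU; apply: le_trans (h _ ch0 _ cU) _.
by rewrite lerD2r ler_wpM2r ?covered_ge0.
Qed.

Lemma seeding_bound0 t b : 0 <= b -> seeding_bound t 0 1 b.
Proof.
move=> b0' ch ch0 U /eqP; rewrite cards_eq0 => /eqP ->.
rewrite /uncovered big_set0 mulr0 addr0 mul1r.
apply: le_trans (seeding_le _ ch0) _; rewrite (cost_split _ finset.set0) /uncovered big_set0 addr0.
exact: covered_ge.
Qed.

Lemma cost0_seeding t ch : cost ch = 0 -> ch != [::] -> V t ch <= 0.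
Proof. by move=> c0 ch0; rewrite -c0; exact: seeding_le. Qed.

(* The bound of Arthur and Vassilvitskii, for no more draws than uncovered clusters. *)
Lemma seeding_bound_few t u : (t <= u)%N ->
  seeding_bound t u (1 + harm t) ((u - t)%:R / u%:R).
Proof.
elim: t u => [|t ih] u tu.
  rewrite subn0 /harm big_ord0 addr0; case: u tu => [|u] _.
    by rewrite mul0r; exact: seeding_bound0.
  by rewrite divff ?pnatr_eq0//; exact: seeding_bound_start.
case: u tu => // u; rewrite ltnS => tu ch ch0 U cU.
have hh := ih u tu; have hw := ih u.+1 (leqW tu).
have fr0 a b : 0 <= a%:R / b%:R :> R by rewrite divr_ge0.
have ha : 0 <= 1 + harm t by rewrite addr_ge0 ?harm_ge0.
have := seeding_step ha (fr0 _ _) ha (fr0 _ _) hh hw ch0 cU.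
set H' := covered ch U; set Uc := uncovered ch U; set Hc := \sum_(_ in ~: U) _ => st.
have U0 : 0 <= Uc by exact: uncovered_ge0.
have Hc0 : 0 <= Hc by exact: sumPhi_ge0.
have HcH : Hc <= H' by exact: covered_ge.
have cE : cost ch = Hc + Uc by exact: cost_split.
have H0 : 0 <= H' by exact: covered_ge0.
have [c0|c0] := eqVneq (cost ch) 0.
  apply: le_trans (cost0_seeding _ c0 ch0) _.
  by rewrite addr_ge0 ?mulr_ge0// ?fr0 ?addr_ge0 ?harm_ge0.
have cp : 0 < cost ch by rewrite lt_def c0 seed_cost_ge0.
rewrite -(ler_pM2r cp); apply: le_trans st _; rewrite cE subSS.
have u1 : 0 < u.+1%:R :> R by rewrite ltr0n.
have -> : (u - t)%:R / u%:R * (u%:R / u.+1%:R) = (u - t)%:R / u.+1%:R :> R.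
  case: (posnP u) tu => [->|up] _; first by rewrite !mul0r.
  by rewrite mulrA divfK// pnatr_eq0 -lt0n.
have -> : (u.+1 - t)%:R / u.+1%:R = (u - t)%:R / u.+1%:R + u.+1%:R^-1 :> R.
  by rewrite subSn// -natr1 mulrDl mul1r.
rewrite harmS; set b := (u - t)%:R / u.+1%:R.
have tu1 : u.+1%:R^-1 <= t.+1%:R^-1 :> R by rewrite lef_pV2 ?posrE ?ltr0n// ler_nat.
have i0 : 0 <= u.+1%:R^-1 :> R by rewrite invr_ge0.
(* What remains after cancellation. A wasted draw leaves the uncovered fraction larger by
   [1 / (u + 1)]; the new harmonic term pays for it because [Hc <= H'] and [t <= u]. *)
suff : Hc * Uc * u.+1%:R^-1 <= t.+1%:R^-1 * H' * (Hc + Uc).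
  rewrite -subr_ge0 => st1; rewrite -subr_ge0; apply: le_trans st1 _.
  by rewrite le_eqVlt; apply/orP; left; apply/eqP; ring.
apply: (@le_trans _ _ (H' * Uc * t.+1%:R^-1)).
  by apply: ler_pM => //; rewrite ?mulr_ge0// ler_wpM2r.
rewrite -mulrA [_ * t.+1%:R^-1]mulrC mulrA [H' * _]mulrC ler_wpM2l ?mulr_ge0 ?invr_ge0//.
by rewrite lerDr.
Qed.

(* With [d] spare draws.  Unless the uncovered cost is already at most
   [u * e d] times the covered cost, a draw wastes itself with probability at
   most [1 / (1 + u * e d)]. *)
Lemma seeding_bound_many (e : nat -> R) : e 0 = 1 -> (forall d, 0 <= e d.+1 <= e d) ->
  (forall d, e d <= e d.+1 ^+ 2 + e d.+1) ->
  forall d u, seeding_bound (u + d) u (1 + u%:R * e d) 0.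
Proof.
move=> e0 emon estep.
have e_ge0 d : 0 <= e d by case: d => [|d]; [rewrite e0|case/andP: (emon d)].
elim=> [|d ihd] u.
  rewrite addn0 e0 mulr1; have := @seeding_bound_few u u (leqnn u).
  by rewrite subnn mul0r; apply: seeding_boundW; rewrite lerD2l harm_le.
elim: u => [|u ihu]; first by rewrite mul0r addr0; exact: seeding_bound0.
move=> ch ch0 U cU; rewrite mul0r addr0.
have hw : seeding_bound (u + d.+1) u.+1 (1 + u.+1%:R * e d) 0.
  by rewrite addnS -addSn.
have a0' v k : 0 <= 1 + v%:R * e k :> R by rewrite addr_ge0 ?mulr_ge0.
have := seeding_step (a0' u d.+1) (lexx 0) (a0' u.+1 d) (lexx 0) ihu hw ch0 cU.
rewrite !mul0r !addr0 addSn.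
set H' := covered ch U; set Uc := uncovered ch U; set Hc := \sum_(_ in ~: U) _ => st.
have U0 : 0 <= Uc by exact: uncovered_ge0.
have Hc0 : 0 <= Hc by exact: sumPhi_ge0.
have HcH : Hc <= H' by exact: covered_ge.
have cE : cost ch = Hc + Uc by exact: cost_split.
have H0 : 0 <= H' by exact: covered_ge0.
have [small|big] := leP Uc (u.+1%:R * e d.+1 * H').
  apply: le_trans (seeding_le _ ch0) _; rewrite cE mulrDl mul1r.
  exact: lerD.
have cp : 0 < cost ch.
  rewrite cE ltr_wpDl//; apply: le_lt_trans big.
  by rewrite !mulr_ge0.
rewrite -(ler_pM2r cp); apply: le_trans st _; rewrite cE.
have /andP[_ em] := emon d; have es := estep d.
set v := u.+1%:R : R; have v0 : 0 <= v by rewrite ler0n.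
have -> : u%:R = v - 1 :> R by rewrite /v -natr1 addrK.
(* On the left the loss by wasted draws, after which [e d] replaces [e d.+1]; on the right the gain
   by hits, after which [v - 1] replaces [v]. The recursion for [e] is tailored to this
   comparison. *)
have h : Hc * (v * (e d - e d.+1)) <= Uc * e d.+1.
  apply: (@le_trans _ _ (H' * (v * e d.+1 ^+ 2))).
    apply: ler_pM => //; first by rewrite mulr_ge0// subr_ge0.
    by rewrite ler_wpM2l// lerBlDr.
  apply: (@le_trans _ _ (v * e d.+1 * H' * e d.+1)).
    by rewrite le_eqVlt; apply/orP; left; apply/eqP; ring.
  by rewrite ler_wpM2r// ltW.
by have := ler_wpM2r H0 h; lra.
Qed.

End SeedingBound.

(* [100 / spare d] decreases like [10 / (9 d)] and satisfies the recursion that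
   [seeding_bound_many] needs; the initial values follow the exact solution
   of [e d = e (d + 1) ^ 2 + e (d + 1)]. *)
Definition spare (d : nat) : nat :=
  if (d < 10)%N then nth 0%N [:: 100; 161; 230; 305; 384; 466; 550; 636; 723; 812]%N d
  else (90 * d)%N.

Lemma spare_ge d : (90 * d <= spare d)%N.
Proof. by do 10 (case: d => [//|d]); rewrite /spare /=. Qed.

Lemma spare_gt0 d : (0 < spare d)%N.
Proof. by case: d => [//|d]; apply: leq_trans (spare_ge _). Qed.

Lemma spare_mono d : (spare d <= spare d.+1)%N.
Proof.
do 10 (case: d => [//|d]); rewrite /spare /=; lia.
Qed.

Lemma spare_step d : (spare d.+1 ^ 2 <= spare d * (100 + spare d.+1))%N.
Proof.
do 10 (case: d => [|d]; first by rewrite /spare /=; lia).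
rewrite /spare /=; nia.
Qed.

Section Approximation.
Context {R : realType}.
Variables (Q : set (R * R)) (phi : R * R -> R) (a0 b0 eps : R) (n : nat)
  (idx : 'I_n -> int * int).

Local Notation w := (weight Q phi a0 b0 eps idx).
Local Notation x := (centroid Q phi a0 b0 eps idx).
Local Notation nearest := (nearest_sqdist Q phi a0 b0 eps idx).
Local Notation prob := (step_prob Q phi a0 b0 eps idx).
Local Notation cost := (seed_cost Q phi a0 b0 eps idx xpredT).
Local Notation V := (seeding Q phi a0 b0 eps idx cost).

Hypothesis w_ge0 : forall i, 0 <= w i.

Definition spare_rate (d : nat) : R := 100 / (spare d)%:R.

Lemma spare_rate_ge0 d : 0 <= spare_rate d. Proof. by rewrite divr_ge0. Qed.

Lemma spare_rate_mono d : 0 <= spare_rate d.+1 <= spare_rate d.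
Proof.
rewrite spare_rate_ge0/= ler_wpM2l// lef_pV2 ?posrE ?ltr0n ?spare_gt0//.
by rewrite ler_nat spare_mono.
Qed.

Lemma spare_rate_anti d d' : (d <= d')%N -> spare_rate d' <= spare_rate d.
Proof.
move=> /subnKC <-; elim: (d' - d)%N => [|m ih]; first by rewrite addn0.
by rewrite addnS; case/andP: (spare_rate_mono (d + m)) => _ h; exact: le_trans h ih.
Qed.

Lemma spare_rate_step d : spare_rate d <= spare_rate d.+1 ^+ 2 + spare_rate d.+1.
Proof.
rewrite /spare_rate; have := spare_step d.
have := spare_gt0 d; have := spare_gt0 d.+1.
move: (spare d) (spare d.+1) => N N'; rewrite -!(ltr0n R) => N'0 N0.
rewrite -(ler_nat R) natrX natrM natrD => h.
rewrite [leRHS](_ : _ = 100 * (100 + N'%:R) / N'%:R ^+ 2); last first.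
  by field; rewrite lt0r_neq0.
by rewrite ler_pdivlMr ?exprn_gt0// mulrAC ler_pdivrMr// -mulrA ler_wpM2l// [leRHS]mulrC.
Qed.

Lemma spare_rate_le d : (0 < d)%N -> spare_rate d <= 10 / (9 * d%:R).
Proof.
move=> d0; have d1 : 0 < d%:R :> R by rewrite ltr0n.
rewrite /spare_rate ler_pdivrMr ?ltr0n ?spare_gt0// mulrAC ler_pdivlMr ?mulr_gt0//.
have := spare_ge d; rewrite -(ler_nat R) natrM => h; lra.
Qed.

Section Clusters.
Variables (C : finType) (cl : 'I_n -> C) (ctr : C -> R * R) (U0 : {set C}).
Hypothesis clU0 : forall j, cl j \in U0.

Definition cluster_cost := \sum_j w j * sqdist (x j) (ctr (cl j)).

(** The first draw covers one cluster, hence [#|U0|.-1]. Being made by weight, it costs that cluster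
    twice its spread on average, less than the factor 5 charged to the others. *)
Lemma seeding_approx t a : 0 <= a -> \sum_j w j = 1 ->
  seeding_bound Q phi a0 b0 eps idx cl t #|U0|.-1 a 0 ->
  V t.+1 [::] <= 5 * a * cluster_cost.
Proof.
move=> a_ge0 W1 hb /=.
pose S := \sum_(A in U0) spread Q phi a0 b0 eps idx cl A.
have S0 : 0 <= S by apply: sumr_ge0 => A _; exact: spread_ge0.
have SO : S <= cluster_cost.
  rewrite /cluster_cost (partition_big cl (mem U0))/=; last by move=> j _; exact: clU0.
  apply: ler_sum => A _; apply: le_trans (spread_le w_ge0 cl A (ctr A)) _.
  by apply: ler_sum => j /eqP ->; rewrite sqdistC.
suff h : V t.+1 [::] <= 5 * a * S.
  by apply: le_trans h _; rewrite ler_wpM2l// mulr_ge0.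
pose sp A := spread Q phi a0 b0 eps idx cl A.
have key i : prob [::] i * V t [:: i] <=
    a * (w i * moment Q phi a0 b0 eps idx cl (cl i) (x i)) + 5 * a * (w i * (S - sp (cl i))).
  rewrite /= W1 divr1 [leRHS](_ : _ = w i * (a * (moment Q phi a0 b0 eps idx cl (cl i) (x i) +
     5 * (S - sp (cl i))))); last by ring.
  rewrite ler_wpM2l//.
  have card : #|U0 :\ cl i| = #|U0|.-1 by rewrite (cardsD1 (cl i) U0) clU0.
  apply: le_trans (hb [:: i] isT _ card) _.
  rewrite mul0r addr0 ler_wpM2l// lerD//.
    rewrite (bigD1 (cl i)) ?inE ?eqxx//= [X in _ + X]big1 ?addr0.
      apply: ler_sum => j _; rewrite ler_wpM2l//= sqdistC; exact: lexx.
    move=> A /andP[]; rewrite !inE negb_and negbK => /orP[->//|AU0] _.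
    rewrite /seed_cost big1// => j /eqP cj; by rewrite -cj clU0 in AU0.
  by rewrite ler_wpM2l// /S (big_setD1 _ (clU0 i))/= addrAC subrr add0r.
apply: le_trans; first by apply: ler_sum => i _; exact: key i.
rewrite big_split/= -!mulr_sumr.
have -> : \sum_i w i * moment Q phi a0 b0 eps idx cl (cl i) (x i) =
    2 * \sum_i w i * sp (cl i).
  rewrite (partition_big cl xpredT)//= [in RHS](partition_big cl xpredT)//= mulr_sumr.
  apply: eq_bigr => A _.
  rewrite (eq_bigr (fun i => w i * moment Q phi a0 b0 eps idx cl A (x i))); last first.
    by move=> i /eqP ->.
  rewrite sum_moment// [in RHS](eq_bigr (fun i => w i * sp A)); last by move=> i /eqP ->.
  by rewrite -mulr_suml mulrA.
have -> : \sum_i w i * (S - sp (cl i)) = S - \sum_i w i * sp (cl i).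
  rewrite -[X in _ = X - _]mul1r -W1 mulr_suml -sumrB; apply: eq_bigr => i _.
  by rewrite mulrBr.
have : 0 <= \sum_i w i * sp (cl i).
  by apply: sumr_ge0 => i _; rewrite mulr_ge0// spread_ge0.
by move: (\sum_i _) => T T0; have := mulr_ge0 a_ge0 T0; lra.
Qed.

Lemma seeding_approx_few t : \sum_j w j = 1 -> #|U0| = t.+1 ->
  V t.+1 [::] <= 5 * (1 + harm t) * cluster_cost.
Proof.
move=> W1 ut; apply: seeding_approx => //; first by rewrite addr_ge0 ?harm_ge0.
rewrite ut; have := @seeding_bound_few R Q phi a0 b0 eps n idx w_ge0 C cl t t (leqnn t).
by rewrite subnn mul0r.
Qed.

Lemma seeding_approx_many t K : \sum_j w j = 1 -> (#|U0| <= K.+1)%N -> (K < t)%N ->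
  V t.+1 [::] <= 5 * (1 + 10 * K%:R / (9 * (t - K)%:R)) * cluster_cost.
Proof.
move=> W1 UK Kt.
have dK : 0 < (t - K)%:R :> R by rewrite ltr0n subn_gt0.
apply: seeding_approx => //.
have e0 : spare_rate 0 = 1 by rewrite /spare_rate /spare /= divff.
have := @seeding_bound_many R Q phi a0 b0 eps n idx w_ge0 C cl
  spare_rate e0 spare_rate_mono spare_rate_step (t - #|U0|.-1)%N #|U0|.-1.
have uK : (#|U0|.-1 <= K)%N by move: UK; case: #|U0|.
rewrite subnKC; last by apply: leq_trans uK (ltnW Kt).
apply: seeding_boundW => //; rewrite lerD2l.
apply: (@le_trans _ _ (K%:R * spare_rate (t - K))).
  apply: ler_pM => //; first exact: spare_rate_ge0.
    by rewrite ler_nat.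
  by apply: spare_rate_anti; rewrite leq_sub2l.
have -> : 10 * K%:R / (9 * (t - K)%:R) = K%:R * (10 / (9 * (t - K)%:R)) :> R by ring.
by rewrite ler_wpM2l// spare_rate_le// subn_gt0.
Qed.

End Clusters.
End Approximation.

(** * Linked configurations *)

Section Distance.
Context {R : realType}.
Implicit Types (p q c : R * R).

Lemma dist2_ge0 p q : 0 <= dist2 p q. Proof. exact: sqrtr_ge0. Qed.

Lemma sqr_dist2 p q : dist2 p q ^+ 2 = sqdist p q.
Proof. by rewrite /dist2 sqr_sqrtr// sqdist_ge0. Qed.

Lemma dist2C p q : dist2 p q = dist2 q p.
Proof. by rewrite /dist2 sqdistC. Qed.

Lemma dist2xx p : dist2 p p = 0.
Proof. by rewrite /dist2 sqdistxx sqrtr0. Qed.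

Lemma dist2_le p q (r : R) : 0 <= r -> (dist2 p q <= r) = (sqdist p q <= r ^+ 2).
Proof. by move=> r0; rewrite -sqr_dist2 ler_sqr// nnegrE dist2_ge0. Qed.

Lemma ler_dist2D c p q : dist2 p q <= dist2 p c + dist2 c q.
Proof.
rewrite dist2_le ?addr_ge0 ?dist2_ge0// sqrrD !sqr_dist2 -mulr_natl.
set a := dist2 p c; set b := dist2 c q.
pose d := (p.1 - c.1) * (c.1 - q.1) + (p.2 - c.2) * (c.2 - q.2).
have -> : sqdist p q = sqdist p c + 2 * d + sqdist c q by rewrite /sqdist /d; ring.
rewrite lerD2r lerD2l ler_wpM2l//.
apply: le_trans (ler_norm d) _; rewrite -ler_sqr ?nnegrE ?mulr_ge0 ?dist2_ge0//.
rewrite real_normK ?num_real// exprMn !sqr_dist2 -subr_ge0.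
(* Lagrange's identity: the defect in Cauchy-Schwarz is the square of a cross product. *)
rewrite [X in 0 <= X](_ : _ = ((p.1 - c.1) * (c.2 - q.2) - (p.2 - c.2) * (c.1 - q.1)) ^+ 2).
  exact: sqr_ge0.
by rewrite /sqdist /d; ring.
Qed.

Definition lerp p q (t : R) : R * R := ((1 - t) * p.1 + t * q.1, (1 - t) * p.2 + t * q.2).

Lemma dist2_lerp_l p q t : 0 <= t -> dist2 (lerp p q t) p = t * dist2 q p.
Proof.
move=> t0; rewrite /dist2 (_ : sqdist _ _ = t ^+ 2 * sqdist q p); last first.
  by rewrite /sqdist /lerp /=; ring.
by rewrite sqrtrM ?sqr_ge0// sqrtr_sqr ger0_norm.
Qed.

Lemma dist2_lerp_r p q t : t <= 1 -> dist2 q (lerp p q t) = (1 - t) * dist2 q p.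
Proof.
move=> t1; rewrite /dist2 (_ : sqdist _ _ = (1 - t) ^+ 2 * sqdist q p); last first.
  by rewrite /sqdist /lerp /=; ring.
by rewrite sqrtrM ?sqr_ge0// sqrtr_sqr ger0_norm ?subr_ge0.
Qed.

End Distance.

Section Linked.
Context {R : realType} (I : finType) (P : I -> R * R) (D : R).

(** Connectedness of the graph of pairs at distance at most [D], in cut form: a crossing argument
    delivers this form directly, and it lets a connected set grow point by point. *)
Definition linked := forall S : {set I}, S != finset.set0 -> S != [set: I]%SET ->
  exists a b, [/\ a \in S, b \notin S & dist2 (P a) (P b) <= D].

Hypotheses (D0 : 0 <= D) (P_linked : linked).

Lemma linked_ind (r : I) (good : {set I} -> Prop) :
  good [set r]%SET ->
  (forall (S : {set I}) a b, a \in S -> b \notin S -> dist2 (P a) (P b) <= D ->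
     good S -> good (b |: S)%SET) ->
  good [set: I]%SET.
Proof.
move=> g1 gS.
suff h m (S : {set I}) : #|~: S| = m -> S != finset.set0 -> good S -> good [set: I]%SET.
  by apply: (h _ [set r]%SET erefl) => //; apply/set0Pn; exists r; rewrite inE.
elim: m S => [|m ih] S cS Sn0 gdS.
  by move/eqP: cS; rewrite cards_eq0 -finset.subset0 -finset.setCT finset.setCS finset.subTset => /eqP <-.
have ST : S != [set: I]%SET.
  by apply/eqP => E; move: cS; rewrite E finset.setCT cards0.
have [a [b [aS bS ab]]] := P_linked Sn0 ST.
apply: (ih (b |: S)%SET); last exact: gS aS bS ab gdS.
  have := cardsD1 b (~: S)%SET; rewrite cS inE bS add1n => -[->].
  by apply: eq_card => c; rewrite !inE negb_or.
by apply/set0Pn; exists b; rewrite !inE eqxx.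
Qed.

(** Each new point lies within [D] of an old one. If it is not within [D / 2] of the current ball,
    moving the centre by [D / 2] towards it and enlarging the radius by [D / 2] suffices. *)
Lemma linked_ball (r : I) : exists c, forall a, dist2 (P a) c <= (#|I|.-1)%:R * D / 2.
Proof.
pose good (S : {set I}) := exists c, forall a, a \in S -> dist2 (P a) c <= (#|S|.-1)%:R * D / 2.
suff [c hc] : good [set: I]%SET by exists c => a; have := hc a; rewrite inE cardsT; exact.
apply: (linked_ind (r := r)).
  by exists (P r) => a; rewrite inE => /eqP ->; rewrite cards1 dist2xx mul0r mul0r.
move=> S a b aS bS ab [c hc].
have cS : (#|(b |: S)%SET|.-1)%:R * D / 2 = (#|S|.-1)%:R * D / 2 + D / 2.
  rewrite cardsU1 bS add1n /= -mulrDl -[X in _ + X]mul1r -mulrDl natr1.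
  by rewrite prednK//; apply/card_gt0P; exists a.
rewrite /good cS; set ra := (#|S|.-1)%:R * D / 2.
have D2 : 0 <= D / 2 by rewrite divr_ge0.
have bc : dist2 (P b) c <= D + ra.
  apply: le_trans (ler_dist2D (P a) _ _) _; apply: lerD; first by rewrite dist2C.
  exact: hc.
have [h|h] := leP (dist2 (P b) c) (ra + D / 2).
  exists c => a'; rewrite !inE => /orP[/eqP ->//|/hc h'].
  by rewrite (le_trans h')// lerDl.
have ra0 : 0 <= ra by rewrite divr_ge0// mulr_ge0.
have t0 : 0 < dist2 (P b) c by apply: le_lt_trans h; rewrite addr_ge0.
pose t := D / 2 / dist2 (P b) c.
have tE : t * dist2 (P b) c = D / 2 by rewrite /t divfK// gt_eqF.
have t_ge0 : 0 <= t by rewrite divr_ge0// ltW.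
have t1 : t <= 1 by rewrite ler_pdivrMr// mul1r; apply: le_trans (ltW h); rewrite lerDr.
exists (lerp c (P b) t) => a'; rewrite !inE => /orP[/eqP ->|/hc h'].
  by rewrite dist2_lerp_r// mulrBl tE mul1r; lra.
apply: le_trans (ler_dist2D c _ _) _; rewrite lerD//.
by rewrite dist2C dist2_lerp_l// tE.
Qed.

(** Depth in a spanning tree rooted at [r]. Of the tree only this is kept: every vertex has an
    ancestor [i] levels up, at distance at most [i * D]. *)
Lemma linked_depth (r : I) : exists dep : I -> nat,
  (forall a, dep a = 0%N -> a = r) /\
  (forall a i, (i <= dep a)%N -> exists2 b, (dep b + i)%N = dep a & dist2 (P a) (P b) <= i%:R * D).
Proof.
pose good (S : {set I}) := exists dep : I -> nat,
  (forall a, a \in S -> dep a = 0%N -> a = r) /\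
  (forall a i, a \in S -> (i <= dep a)%N ->
     exists b, [/\ b \in S, (dep b + i)%N = dep a & dist2 (P a) (P b) <= i%:R * D]).
suff [dep [h1 h2]] : good [set: I]%SET.
  exists dep; split=> [a|a i ia]; first by apply: h1; rewrite inE.
  by have [|b [_ ? ?]] := h2 a i _ ia; [rewrite inE|exists b].
apply: (linked_ind (r := r)).
  exists (fun=> 0%N); split=> [a|a i]; rewrite inE => /eqP -> //.
  rewrite leqn0 => /eqP ->; exists r; split; rewrite ?inE//.
  by rewrite dist2xx mul0r.
move=> S a b aS bS ab [dep [h1 h2]].
pose dep' c := if c == b then (dep a).+1 else dep c.
have depS c : c \in S -> dep' c = dep c.
  by rewrite /dep'; case: eqVneq => // ->; rewrite (negPf bS).
exists dep'; split=> [c|c i].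
  rewrite !inE => /orP[/eqP ->|cS]; first by rewrite /dep' eqxx.
  by rewrite depS//; exact: h1.
rewrite !inE => /orP[/eqP ->|cS].
  rewrite {1}/dep' eqxx; case: i => [_|i ia].
    by exists b; split; rewrite ?inE ?eqxx ?addn0// dist2xx mul0r.
  have [e [eS eE ed]] := h2 a i aS ia.
  exists e; split; first by rewrite !inE eS orbT.
    by rewrite depS// /dep' eqxx addnS eE.
  apply: le_trans (ler_dist2D (P a) _ _) _.
  by rewrite -natr1 mulrDl mul1r addrC lerD// dist2C.
rewrite depS// => /(h2 c i cS) [e [eS eE ed]].
by exists e; split; rewrite ?depS// !inE eS orbT.
Qed.

(* Keep the root and the residue class of depths modulo [d + 1] with the
   fewest points: every point has an ancestor in it at most [d] steps away. *)
Lemma linked_dominating (r : I) (d : nat) : exists Z : {set I},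
  [/\ r \in Z, (#|Z| <= (#|I|.-1 %/ d.+1).+1)%N &
      forall a, exists2 z, z \in Z & dist2 (P a) (P z) <= d%:R * D].
Proof.
have [dep [h1 h2]] := linked_depth r.
pose cls (i : 'I_d.+1) := [set a | (a != r) && (dep a %% d.+1 == i)%N]%SET.
have sumc : (\sum_i #|cls i| = #|I|.-1)%N.
  have -> : #|I|.-1 = #|[set~ r]%SET| by rewrite cardsC1.
  rewrite -sum1_card (partition_big (fun a => inord (dep a %% d.+1) : 'I_d.+1) xpredT)//=.
  apply: eq_bigr => i _; rewrite -sum1_card; apply: eq_bigl => a; rewrite !inE.
  congr (_ && _); rewrite -val_eqE /= inordK//; exact: ltn_pmod.
have [i hi] : exists i, (#|cls i| <= #|I|.-1 %/ d.+1)%N.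
  apply/existsP; rewrite -[[exists _, _]]negbK negb_exists; apply/negP => /forallP h.
  have : (\sum_(i < d.+1) (#|I|.-1 %/ d.+1).+1 <= \sum_i #|cls i|)%N.
    by apply: leq_sum => i _; rewrite ltnNge; exact: h.
  rewrite sumc sum_nat_const card_ord leqNgt mulnC ltn_ceil//.
exists (r |: cls i)%SET; split; first by rewrite !inE eqxx.
  by apply: leq_trans (subset_leq_card (subxx _)) _; rewrite cardsU1 -add1n leq_add// leq_b1.
move=> a; have [ia|ai] := leqP i (dep a).
  pose s := ((dep a - i) %% d.+1)%N.
  have sa : (s <= dep a)%N by apply: leq_trans (leq_mod _ _) (leq_subr _ _).
  have [b bE bd] := h2 a s sa.
  exists b; last first.
    apply: le_trans bd _; rewrite ler_wpM2r// ler_nat -ltnS; exact: ltn_pmod.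
  rewrite !inE; case: eqVneq => //= _.
  have -> : dep b = ((dep a - i) %/ d.+1 * d.+1 + i)%N.
    by move: bE; rewrite /s; have := divn_eq (dep a - i) d.+1; lia.
  by rewrite modnMDl modn_small.
(* Here the depth is below [i], hence at most [d], and the root serves; this is why [Z] contains
   it. *)
have [b bE bd] := h2 a (dep a) (leqnn _).
exists b; first by rewrite (h1 b) ?inE ?eqxx//; lia.
apply: le_trans bd _; rewrite ler_wpM2r// ler_nat.
by rewrite -ltnS; apply: leq_trans ai (ltnW (ltn_ord i)).
Qed.

End Linked.

(** * Area of neighbourhoods of linked points and counting of grid squares *)

Section Area.
Context {R : realType}.

HB.instance Definition _ := Measure.on (@area R).

Lemma area_rect (A B : set R) : measurable A -> measurable B ->
  area (A `*` B) = (lebesgue_measure A * lebesgue_measure B)%E.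
Proof.
move=> mA mB.
exact: (@product_measure1E _ _ _ _ R (@lebesgue_measure R) (@lebesgue_measure R)).
Qed.

Lemma measurable_linear (a b : R) : measurable_fun setT (fun q : R * R => a * q.1 + b * q.2).
Proof.
by apply: measurable_funD; apply: measurable_funM.
Qed.

Definition line (a b c : R) : set (R * R) := [set q | a * q.1 + b * q.2 = c].

Lemma measurable_line a b c : measurable (line a b c).
Proof.
have := @measurable_linear a b measurableT [set c] (measurable_set1 c).
by rewrite setTI.
Qed.

Lemma area_line a b c : (a, b) != (0, 0) -> area (line a b c) = 0.
Proof.
have [->|b0] := eqVneq b 0.
  rewrite xpair_eqE eqxx andbT => a0.
  have -> : line a 0 c = [set c / a] `*` setT.
    apply/seteqP; split=> [[u v]|[u v]]; rewrite /line /= mul0r addr0.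
      by move=> <-; split=> //; rewrite mulrC mulKf.
    by move=> [-> _]; rewrite mulrC divfK.
  rewrite area_rect//.
  by rewrite lebesgue_measure_set1 mul0e.
move=> _; rewrite /area /product_measure1.
apply: integral0_eq => u _ /=.
have -> : xsection (line a b c) u = [set (c - a * u) / b].
  apply/seteqP; split=> v; rewrite /xsection /= ?inE /line /=.
    by move=> <-; rewrite addrC addKr mulrC mulKf.
  by move=> ->; rewrite [b * _]mulrC divfK// addrC subrK.
exact: lebesgue_measure_set1.
Qed.

Definition box (p : R * R) (r : R) : set (R * R) :=
  `[p.1 - r, p.1 + r]%classic `*` `[p.2 - r, p.2 + r]%classic.

Lemma measurable_box p r : measurable (box p r).
Proof. by apply: measurableX; exact: measurable_itv. Qed.

Lemma lebesgue_seg (u v : R) : u <= v -> lebesgue_measure (`[u, v]%classic : set R) = (v - u)%:E.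
Proof.
rewrite lebesgue_measure_itv /= lte_fin le_eqVlt => /orP[/eqP ->|->].
  by rewrite ltxx subrr.
by rewrite -EFinB.
Qed.

Lemma area_box p r : 0 <= r -> area (box p r) = ((2 * r) ^+ 2)%:E.
Proof.
move=> r0; rewrite area_rect; [|exact: measurable_itv|exact: measurable_itv].
rewrite !lebesgue_seg; [|lra|lra].
by rewrite -EFinM; congr EFin; ring.
Qed.

(** Contains the part of [[v - r, v + r]] outside [[u - r, u + r]]. It may contain more when the two
    are disjoint, but its length is always [|v - u|]. *)
Definition shift_seg (u v r : R) : set R :=
  `[(if u <= v then u + r else v - r), (if u <= v then v + r else u - r)]%classic.

Lemma lebesgue_shift_seg u v r : lebesgue_measure (shift_seg u v r) = `|v - u|%:E.
Proof.
rewrite /shift_seg; case: ifPn; rewrite -?ltNge => uv; (rewrite lebesgue_seg; last lra).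
- by rewrite ger0_norm ?subr_ge0//; congr EFin; ring.
- by rewrite ltr0_norm ?subr_lt0//; congr EFin; ring.
Qed.

Lemma box_diff p q r : 0 <= r ->
  box q r `<=` box p r `|` (shift_seg p.1 q.1 r `*` `[q.2 - r, q.2 + r]%classic)
    `|` (`[q.1 - r, q.1 + r]%classic `*` shift_seg p.2 q.2 r).
Proof.
move=> r0 [u v] []; rewrite /= !in_itv/= => /andP[u1 u2] /andP[v1 v2].
have aux (s t z : R) : t - r <= z -> z <= t + r ->
    (s - r <= z <= s + r) \/ shift_seg s t r z.
  move=> z1 z2; rewrite /shift_seg /= in_itv/=; case: ifPn; rewrite -?ltNge => st.
    by case: (leP z (s + r)) => h; [left|right]; lra.
  by case: (leP (s - r) z) => h; [left|right]; lra.
have [hu|hu] := aux p.1 q.1 u u1 u2; last first.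
  by left; right; split=> //=; rewrite v1 v2.
have [hv|hv] := aux p.2 q.2 v v1 v2; last first.
  by right; split=> //=; rewrite u1 u2.
by left; left; split; rewrite /= in_itv.
Qed.

Lemma norm1_le_dist2 (p q : R * R) : `|q.1 - p.1| + `|q.2 - p.2| <= Num.sqrt 2 * dist2 p q.
Proof.
rewrite -ler_sqr ?nnegrE ?addr_ge0 ?mulr_ge0 ?sqrtr_ge0 ?dist2_ge0//.
rewrite exprMn sqr_sqrtr// sqr_dist2 /sqdist.
have -> : (p.1 - q.1) ^+ 2 = `|q.1 - p.1| ^+ 2 by rewrite real_normK ?num_real// -sqrrN opprB.
have -> : (p.2 - q.2) ^+ 2 = `|q.2 - p.2| ^+ 2 by rewrite real_normK ?num_real// -sqrrN opprB.
rewrite -subr_ge0; set a := `|_ - _|; set b := `|_ - _|.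
by rewrite [X in 0 <= X](_ : _ = (a - b) ^+ 2) ?sqr_ge0//; ring.
Qed.

(* A box translated by (u, v) uncovers rectangles of areas 2r|u| and 2r|v|. *)
Lemma area_linked_boxes (I : finType) (P : I -> R * R) (D r : R) (i0 : I) :
  0 <= D -> 0 <= r -> linked P D ->
  (area (\big[setU/set0]_(i : I) box (P i) r) <=
   ((2 * r) ^+ 2 + (#|I|.-1)%:R * (2 * r * (Num.sqrt 2 * D)))%:E)%E.
Proof.
move=> D0 r0 PD.
pose U (S : {set I}) := \big[setU/set0]_(i in S) box (P i) r.
have mU S : measurable (U S) by apply: bigsetU_measurable => i _; exact: measurable_box.
pose good (S : {set I}) := S != finset.set0 /\ (area (U S) <=
   ((2 * r) ^+ 2 + (#|S|.-1)%:R * (2 * r * (Num.sqrt 2 * D)))%:E)%E.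
suff [_] : good [set: I]%SET.
  by rewrite /U cardsT; congr (area _ <= _)%E; apply: eq_bigl => i; rewrite inE.
apply: (linked_ind PD (r := i0)).
  split; first by apply/set0Pn; exists i0; rewrite inE.
  by rewrite /U big_set1 cards1 mul0r addr0 area_box.
move=> S a b aS bS ab [Sn0 gS]; split; first by apply/set0Pn; exists b; rewrite !inE eqxx.
have -> : (#|(b |: S)%SET|.-1)%:R = (#|S|.-1)%:R + 1 :> R.
  by rewrite cardsU1 bS add1n /= natr1 prednK// card_gt0.
rewrite [(#|S|.-1%:R + 1) * _]mulrDl mul1r addrA EFinD.
have mX1 : measurable (shift_seg (P a).1 (P b).1 r `*` `[(P b).2 - r, (P b).2 + r]%classic).
  by apply: measurableX; exact: measurable_itv.
have mX2 : measurable (`[(P b).1 - r, (P b).1 + r]%classic `*` shift_seg (P a).2 (P b).2 r).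
  by apply: measurableX; exact: measurable_itv.
have sub : U (b |: S)%SET `<=` U S `|`
   ((shift_seg (P a).1 (P b).1 r `*` `[(P b).2 - r, (P b).2 + r]%classic) `|`
    (`[(P b).1 - r, (P b).1 + r]%classic `*` shift_seg (P a).2 (P b).2 r)).
  rewrite /U big_setU1//= => q [/(@box_diff (P a) _ _ r0)|]; last by left.
  move=> [[qa|]|]; [left|by right; left|by right; right].
  by rewrite (bigD1 a)//=; left.
have mX := measurableU _ _ mX1 mX2.
apply: (@le_trans _ _ (area (U S `|` _))).
  exact: (le_measure (@area R) (mem_set (mU _)) (mem_set (measurableU _ _ (mU S) mX)) sub).
apply: (le_trans (measureU2 (@area R) (mU S) mX)).
rewrite leeD//; apply: (le_trans (measureU2 (@area R) mX1 mX2)).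
set X1 := _ `*` _; set X2 := _ `*` _; apply: (@le_trans _ _ (area X1 + area X2)%E) => //.
rewrite /X1 /X2 !area_rect; try exact: measurable_itv.
rewrite !lebesgue_shift_seg !lebesgue_seg; [|lra|lra].
rewrite -!EFinM -EFinD lee_fin.
have h : 2 * r * (`|(P b).1 - (P a).1| + `|(P b).2 - (P a).2|) <= 2 * r * (Num.sqrt 2 * D).
  rewrite ler_wpM2l ?mulr_ge0//; apply: le_trans (norm1_le_dist2 _ _) _.
  by rewrite ler_wpM2l ?sqrtr_ge0.
by apply: le_trans h; rewrite le_eqVlt; apply/orP; left; apply/eqP; ring.
Qed.

Lemma grid_squareE (a0 b0 eps : R) ij : grid_square a0 b0 eps ij =
  `[a0 + ij.1%:~R * eps, a0 + (ij.1 + 1)%:~R * eps[%classic `*`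
  `[b0 + ij.2%:~R * eps, b0 + (ij.2 + 1)%:~R * eps[%classic.
Proof.
by apply/seteqP; split=> q []; rewrite /= !in_itv/= => h1 h2; split; rewrite /= ?in_itv.
Qed.

Lemma measurable_grid_square (a0 b0 eps : R) ij : measurable (grid_square a0 b0 eps ij).
Proof. by rewrite grid_squareE; apply: measurableX; exact: measurable_itv. Qed.

Lemma area_grid_square (a0 b0 eps : R) ij : 0 < eps ->
  area (grid_square a0 b0 eps ij) = (eps ^+ 2)%:E.
Proof.
move=> e0; rewrite grid_squareE area_rect; try exact: measurable_itv.
rewrite !lebesgue_measure_itv /= !lte_fin !ltrD2l !ltr_pM2r// !ltr_int !ltzD1 !lexx.
rewrite -!EFinB -EFinM !intrD; congr EFin; ring.
Qed.

Lemma grid_index (eps a z : R) (i j : int) : 0 < eps ->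
  a + i%:~R * eps <= z < a + (i + 1)%:~R * eps ->
  a + j%:~R * eps <= z < a + (j + 1)%:~R * eps -> i = j.
Proof.
move=> e0 /andP[i1 i2] /andP[j1 j2].
have aux (u v : int) : a + u%:~R * eps <= z -> z < a + (v + 1)%:~R * eps -> (u <= v)%R.
  move=> h1 h2; have := le_lt_trans h1 h2.
  by rewrite ltrD2l ltr_pM2r// ltr_int ltzD1.
by apply/eqP; rewrite eq_le (aux _ _ i1 j2) (aux _ _ j1 i2).
Qed.

Lemma grid_square_disjoint (a0 b0 eps : R) ij ij' q : 0 < eps ->
  grid_square a0 b0 eps ij q -> grid_square a0 b0 eps ij' q -> ij = ij'.
Proof.
move=> e0 [h1 h2] [h1' h2']; case: ij h1 h2 => i j h1 h2; case: ij' h1' h2' => i' j' h1' h2'.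
by congr pair; [exact: grid_index e0 h1 h1'|exact: grid_index e0 h2 h2'].
Qed.

Lemma grid_square_width (a0 b0 eps : R) ij p q :
  grid_square a0 b0 eps ij p -> grid_square a0 b0 eps ij q ->
  `|p.1 - q.1| <= eps /\ `|p.2 - q.2| <= eps.
Proof.
move=> [/andP[p1 p2] /andP[p3 p4]] [/andP[q1 q2] /andP[q3 q4]].
move: p2 p4 q2 q4; rewrite !intrD !mulrDl !mul1r => p2 p4 q2 q4.
by rewrite !ler_norml; split; lra.
Qed.

(** Distinct squares are disjoint and have area [eps ^ 2]. A square with a point within [rho] of
    some [P i] lies inside the box of half-side [rho + eps] about it, so the area of the union of
    boxes limits their number. *)
Lemma count_near_squares (I : finType) (P : I -> R * R) (D rho a0 b0 eps : R) (i0 : I)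
    (n : nat) (idx : 'I_n -> int * int) (T : {set 'I_n}) :
  0 <= D -> 0 <= rho -> 0 < eps -> linked P D -> injective idx ->
  (forall t, t \in T -> exists q i, grid_square a0 b0 eps (idx t) q /\ dist2 q (P i) <= rho) ->
  #|T|%:R * eps ^+ 2 <= (2 * (rho + eps)) ^+ 2 +
    (#|I|.-1)%:R * (2 * (rho + eps) * (Num.sqrt 2 * D)).
Proof.
move=> D0 rho0 e0 PD idx_inj Tnear.
pose sq t := grid_square a0 b0 eps (idx t).
pose W := \big[setU/set0]_(t <- enum T) sq t.
have mW : measurable W by apply: bigsetU_measurable => i _; exact: measurable_grid_square.
have areaW : area W = (#|T|%:R * eps ^+ 2)%:E.
  have mSq t : measurable (sq t) by exact: measurable_grid_square.
  have tr : trivIset [set` enum T] sq.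
    by move=> t u _ _ [q [tq uq]]; apply: idx_inj; exact: grid_square_disjoint tq uq.
  have := @ge0_integral_bigsetU _ _ R (@area R) _ sq (cst 1%E) (enum T) mSq (enum_uniq T) tr
    (measurable_cst _) (fun _ _ => lee01).
  rewrite -/W integral_cst// mul1e => ->.
  rewrite (eq_bigr (fun=> (eps ^+ 2)%:E)); last first.
    by move=> t _; rewrite integral_cst ?mul1e; [exact: area_grid_square|exact: mSq].
  by rewrite sumEFin big_enum sumr_const; congr EFin; rewrite mulr_natl.
have r0 : 0 <= rho + eps by rewrite addr_ge0// ltW.
rewrite -lee_fin -areaW; apply: le_trans (area_linked_boxes i0 D0 r0 PD).
apply: le_measure; rewrite ?inE//.
  by apply: bigsetU_measurable => i _; exact: measurable_box.
rewrite /W -bigcup_seq => q [t]; rewrite /= mem_enum => tT qt.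
have [p [i [pt pi]]] := Tnear t tT; rewrite (bigD1 i)//=; left.
have [w1 w2] := grid_square_width qt pt.
have := pi; rewrite dist2_le// /sqdist => pi2.
have c1 : `|p.1 - (P i).1| <= rho.
  rewrite -ler_sqr ?nnegrE// real_normK ?num_real//; apply: le_trans pi2.
  by rewrite lerDl sqr_ge0.
have c2 : `|p.2 - (P i).2| <= rho.
  rewrite -ler_sqr ?nnegrE// real_normK ?num_real//; apply: le_trans pi2.
  by rewrite lerDr sqr_ge0.
move: w1 w2 c1 c2; rewrite !ler_norml => /andP[? ?] /andP[? ?] /andP[? ?] /andP[? ?].
by split; rewrite /= in_itv/=; apply/andP; split; lra.
Qed.

End Area.

(** * Connectedness of the Voronoi neighbour graph *)

Section MinDistance.
Context {R : realType} (I : finType) (P : I -> R * R).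

(** [i0] supplies the initial value of the minimum; for [i0] in [S] this is the minimum over [S]. *)
Definition min_sqdist (S : {set I}) (i0 : I) (q : R * R) : R :=
  \big[Num.min/sqdist q (P i0)]_(i in S) sqdist q (P i).

Lemma min_sqdist_le (S : {set I}) i0 q i : i \in S -> min_sqdist S i0 q <= sqdist q (P i).
Proof. exact: bigmin_le_cond. Qed.

Lemma min_sqdist_ex (S : {set I}) i0 q : i0 \in S ->
  exists2 i, i \in S & min_sqdist S i0 q = sqdist q (P i).
Proof.
move=> i0S; rewrite /min_sqdist.
apply: (big_rec (fun v => exists2 i, i \in S & v = sqdist q (P i))); first by exists i0.
move=> i v iS [j jS ->]; rewrite minEle; case: ifP => _; first by exists i.
by exists j.
Qed.

Lemma min_sqdist_ge0 (S : {set I}) i0 q : i0 \in S -> 0 <= min_sqdist S i0 q.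
Proof. by move=> /(min_sqdist_ex q) [i _ ->]; exact: sqdist_ge0. Qed.

Lemma continuous_sqdist_lerp (u v p : R * R) :
  continuous (fun t : R => sqdist (lerp u v t) p).
Proof.
have aff (a b c : R) : continuous (fun t : R => ((1 - t) * a + t * b - c) ^+ 2).
  have -> : (fun t : R => ((1 - t) * a + t * b - c) ^+ 2) =
            (fun t => (a - c + t * (b - a)) * (a - c + t * (b - a))).
    by apply/funext => t; ring.
  have h : continuous (fun t : R => a - c + t * (b - a)).
    by move=> t; apply: cvgD; [exact: cvg_cst|apply: cvgM; [exact: cvg_id|exact: cvg_cst]].
  by move=> t; apply: cvgM; exact: h.
by move=> t; apply: cvgD; exact: aff.
Qed.

Lemma continuous_min_sqdist_lerp (S : {set I}) i0 (u v : R * R) :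
  continuous (fun t : R => min_sqdist S i0 (lerp u v t)).
Proof.
rewrite /min_sqdist; elim: (index_enum I) => [|i s ih].
  by under eq_fun do rewrite big_nil; exact: continuous_sqdist_lerp.
under eq_fun do rewrite big_cons; case: (i \in S) => // t.
exact: (@continuous_min R R _ _ t (@continuous_sqdist_lerp u v (P i) t) (ih t)).
Qed.

End MinDistance.

Section VoronoiLinked.
Context {R : realType} (Q : set (R * R)) (k : nat) (P : 'I_k -> R * R) (D : R).
Hypotheses (D0 : 0 <= D) (mQ : measurable Q) (areaQ : area Q <> 0)
  (convQ : forall p q (t : R), Q p -> Q q -> 0 <= t <= 1 -> Q (lerp p q t))
  (QP : forall i, Q (P i))
  (nbr : forall a b, a != b -> voronoi_neighbors Q P a b -> dist2 (P a) (P b) <= D).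

Section Cut.
Variables (S : {set 'I_k}) (a b : 'I_k).
Hypotheses (aS : a \in S) (bS : b \notin S).
Let mS := min_sqdist P S a.
Let mT := min_sqdist P (~: S)%SET b.

Lemma voronoi_tie y : Q y -> mS y = mT y ->
  exists a' b', [/\ a' \in S, b' \notin S & (voronoi Q P a' `&` voronoi Q P b') y].
Proof.
move=> Qy e; have bT : b \in (~: S)%SET by rewrite inE.
have [a' a'S ea] := min_sqdist_ex P y aS; have [b' b'T eb] := min_sqdist_ex P y bT.
exists a', b'; split=> //; first by move: b'T; rewrite inE.
have all j : mS y <= sqdist y (P j).
  have [jS|jS] := boolP (j \in S); first exact: min_sqdist_le.
  by rewrite e; apply: min_sqdist_le; rewrite inE.
by split; split=> // j _; [rewrite -ea|rewrite -eb -/(mT y) -e]; exact: all.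
Qed.

(** Along the segment, inside Q by convexity, the difference of the distances to the two sides of
    the cut changes sign; where it vanishes, nearest points of both sides tie. *)
Lemma voronoi_crossing u v : Q u -> Q v -> mS u < mT u -> mT v < mS v ->
  exists t a' b', [/\ a' \in S, b' \notin S & (voronoi Q P a' `&` voronoi Q P b') (lerp u v t)].
Proof.
move=> Qu Qv hu hv.
pose f t := mS (lerp u v t) - mT (lerp u v t).
have fc : continuous f.
  by move=> t; apply: cvgB; exact: continuous_min_sqdist_lerp.
have l0 : lerp u v 0 = u by case: (u) => u1 u2; rewrite /lerp /=; congr pair; ring.
have l1 : lerp u v 1 = v by case: (v) => v1 v2; rewrite /lerp /=; congr pair; ring.
have f0 : f 0 < 0 by rewrite /f l0 subr_lt0.
have f1 : 0 < f 1 by rewrite /f l1 subr_gt0.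
have [||t] := @IVT R f 0 1 0 ler01.
- exact: continuous_subspaceT.
- by rewrite ge_min (ltW f0) le_max (ltW f1) orbT.
rewrite in_itv/= => t01 /eqP; rewrite subr_eq0 => /eqP ft.
have [|a' [b' h]] := @voronoi_tie (lerp u v t) _ ft; first exact: convQ.
by exists t, a', b'.
Qed.

End Cut.

(* If no edge of length at most [D] crossed the cut, cells on its two sides would meet in at
   most one point.  The broken line from [P a] through [m] to [P b] crosses the cut in one of
   these finitely many points, and a generic [m] of Q avoids them all. *)
Lemma voronoi_linked : linked P D.
Proof.
move=> S /set0Pn [a aS] ST.
have [b bS] : exists b, b \notin S.
  apply/existsP; rewrite -negb_forall; apply: contra ST => /forallP h.
  by apply/eqP/setP => i; rewrite h inE.
apply: contrapT => none.
have apart a' b' : a' \in S -> b' \notin S -> P a' <> P b'.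
  by move=> h1 h2 e; apply: none; exists a', b'; split; rewrite // e dist2xx.
have single a' b' : a' \in S -> b' \notin S ->
    forall q1 q2, (voronoi Q P a' `&` voronoi Q P b') q1 ->
    (voronoi Q P a' `&` voronoi Q P b') q2 -> q1 = q2.
  move=> h1 h2 q1 q2 v1 v2; apply: contrapT => q12; apply: none; exists a', b'.
  split=> //; apply: nbr; last by exists q1, q2.
  by apply: contraNneq h2 => <-.
(* For disjoint cells the default [P a] is returned, which adds at most one more null line. *)
pose tie (i : 'I_k * 'I_k) := xget (P a) (voronoi Q P i.1 `&` voronoi Q P i.2).
(* The line through [p] and [f]: from an [m] outside it, the segment to [p] cannot pass through
   [f]. *)
pose bad (p f : R * R) : set (R * R) := if f == p then set0 else
  line (f.2 - p.2) (p.1 - f.1) ((f.2 - p.2) * p.1 + (p.1 - f.1) * p.2).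
have bad0 p f : (@area R).-negligible (bad p f).
  rewrite /bad; case: eqP => [_|fp]; first exact: negligible_set0.
  apply/negligibleP; first exact: measurable_line.
  apply: area_line; apply/eqP => -[/eqP]; rewrite subr_eq0 => /eqP e2 /eqP.
  rewrite subr_eq0 => /eqP e1; apply: fp; move: e1 e2.
  by case: (f) (p) => [f1 f2] [p1 p2] /= -> ->.
pose N := \big[setU/set0]_i (bad (P a) (tie i) `|` bad (P b) (tie i)).
have N0 : (@area R).-negligible N.
  rewrite /N; elim/big_ind : _ => [|A B|i _]; first exact: negligible_set0.
    exact: negligibleU.
  by apply: negligibleU; exact: bad0.
have [m Qm Nm] : exists2 m, Q m & ~ N m.
  apply: contrapT => h; apply: areaQ; apply: measure_negligible => //.
  apply: (negligibleS _ N0) => q Qq; apply: contrapT => Nq; apply: h; by exists q.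
have onbad p f t a' b' : a' \in S -> b' \notin S -> (p = P a \/ p = P b) ->
    (voronoi Q P a' `&` voronoi Q P b') f -> f = lerp m p t -> False.
  move=> a'S b'S pab vf ef; apply: Nm.
  have tf : tie (a', b') = f.
    apply: (single a' b') => //; exact: (xgetPex (P a) (ex_intro _ f vf)).
  (* [P a] and [P b] lie in no cell of the opposite side: they would coincide with a point across
     the cut, against [apart]. *)
  have fp : f != p.
    apply/eqP => fp; move: vf; rewrite fp => -[[_ va] [_ vb]].
    case: pab => pE; rewrite pE in va vb.
      have ab' : a != b' by apply: contraNneq b'S => <-.
      have := vb a ab'; rewrite sqdistxx => h.
      have /sqdist_eq0 : sqdist (P a) (P b') = 0 by apply/eqP; rewrite eq_le h sqdist_ge0.
      exact: apart.
    have ba' : b != a' by apply: contraNneq bS => ->.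
    have := va b ba'; rewrite sqdistxx => h.
    have /sqdist_eq0 /esym : sqdist (P b) (P a') = 0 by apply/eqP; rewrite eq_le h sqdist_ge0.
    exact: apart.
  rewrite /N (bigD1 (a', b'))//=; left; rewrite tf.
  have : bad p f m.
    rewrite /bad (negPf fp) /line /= ef /lerp /=; ring.
  by case: pab => <-; [left|right].
have ltS p a' : p = P a' -> a' \in S -> min_sqdist P S a p < min_sqdist P (~: S)%SET b p.
  move=> pE a'S; have [|b' b'T ->] := @min_sqdist_ex _ _ P (~: S)%SET b p; first by rewrite inE.
  apply: le_lt_trans (min_sqdist_le P a p a'S) _.
  rewrite pE sqdistxx lt_def sqdist_ge0 andbT; apply/eqP => /sqdist_eq0.
  by apply: apart => //; move: b'T; rewrite inE.
have ltT p b' : p = P b' -> b' \notin S -> min_sqdist P (~: S)%SET b p < min_sqdist P S a p.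
  move=> pE b'S; have [a' a'S ->] := @min_sqdist_ex _ _ P S a p aS.
  have b'T : b' \in (~: S)%SET by rewrite inE.
  apply: le_lt_trans (min_sqdist_le P b p b'T) _.
  rewrite pE sqdistxx lt_def sqdist_ge0 andbT; apply/eqP => /sqdist_eq0/esym.
  exact: apart.
have [lt|gt|e] := ltgtP (min_sqdist P S a m) (min_sqdist P (~: S)%SET b m).
- have [t [a' [b' [a'S b'S v]]]] := voronoi_crossing aS bS Qm (QP b) lt (ltT _ _ erefl bS).
  by apply: (onbad (P b) _ t a' b' a'S b'S _ v) => //; right.
- have [t [a' [b' [a'S b'S v]]]] := voronoi_crossing aS bS (QP a) Qm (ltS _ _ erefl aS) gt.
  apply: (onbad (P a) _ (1 - t) a' b' a'S b'S _ v); first by left.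
  by rewrite /lerp /=; congr pair; ring.
- have [a' [b' [a'S b'S v]]] := voronoi_tie aS bS Qm e.
  apply: (onbad (P a) _ 0 a' b' a'S b'S _ v); first by left.
  by case: (m) => m1 m2; rewrite /lerp /=; congr pair; ring.
Qed.

End VoronoiLinked.

(** * Integrals over Voronoi and grid cells *)

Section Density.
Context {R : realType}.
Variables (Q : set (R * R)) (phi : R * R -> R).
Hypotheses (bQ : exists M : R, forall q, Q q -> `|q.1| <= M /\ `|q.2| <= M)
  (mQ : measurable Q) (mphi : measurable_fun Q phi) (phi0 : forall q, Q q -> 0 <= phi q)
  (phi1 : (\int[area]_(q in Q) (phi q)%:E = 1)%E).

(** A class of integrands closed under the operations used below, whose products with [phi] are
    integrable on Q. *)
Definition tame (f : R * R -> R) :=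
  measurable_fun setT f /\ exists M, forall q, Q q -> `|f q| <= M.

Lemma tame_cst (c : R) : tame (fun=> c).
Proof. by split; [exact: measurable_cst|exists `|c|]. Qed.

Lemma tame_fst : tame fst.
Proof. by split; [exact: measurable_fst|case: bQ => M h; exists M => q /h []]. Qed.

Lemma tame_snd : tame snd.
Proof. by split; [exact: measurable_snd|case: bQ => M h; exists M => q /h []]. Qed.

Lemma tameD f g : tame f -> tame g -> tame (fun q => f q + g q).
Proof.
move=> [mf [M hf]] [mg [N hg]]; split; first exact: measurable_funD.
by exists (M + N) => q Qq; rewrite (le_trans (ler_normD _ _))// lerD ?hf ?hg.
Qed.

Lemma tameM f g : tame f -> tame g -> tame (fun q => f q * g q).
Proof.
move=> [mf [M hf]] [mg [N hg]]; split; first exact: measurable_funM.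
by exists (M * N) => q Qq; rewrite normrM ler_pM ?hf ?hg.
Qed.

Lemma tame_min f g : tame f -> tame g -> tame (fun q => Num.min (f q) (g q)).
Proof.
move=> [mf [M hf]] [mg [N hg]]; split; first exact: measurable_minr.
exists (Num.max M N) => q Qq; rewrite le_max minEle.
by case: ifP => _; rewrite ?hf ?hg ?orbT.
Qed.

Lemma tame_sqdist p : tame (fun q => sqdist q p).
Proof.
by rewrite /sqdist; apply: tameD; apply: tameM; apply: tameD;
  (exact: tame_fst || exact: tame_snd || exact: tame_cst).
Qed.

Lemma tame_min_sqdist (I : finType) (P : I -> R * R) (S : {set I}) i0 :
  tame (min_sqdist P S i0).
Proof.
rewrite /min_sqdist; elim: (index_enum I) => [|i s ih].
  by under eq_fun do rewrite big_nil; exact: tame_sqdist.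
under eq_fun do rewrite big_cons; case: (i \in S) => //.
by apply: tame_min => //; exact: tame_sqdist.
Qed.

Lemma integrable_phi A : measurable A -> A `<=` Q -> (@area R).-integrable A (EFin \o phi).
Proof.
move=> mA AQ; apply: (@integrableS _ _ R (@area R) Q) => //; apply/integrableP; split.
  exact/measurable_EFinP.
apply: (@le_lt_trans _ _ 1%E); last exact: ltry.
rewrite -phi1 le_eqVlt; apply/orP; left; apply/eqP; apply: eq_integral => q.
by rewrite inE => Qq /=; rewrite ger0_norm// phi0.
Qed.

Definition wint (A : set (R * R)) (f : R * R -> R) : R :=
  Rintegral area A (fun q => f q * phi q).

Lemma integrable_tame A f : measurable A -> A `<=` Q -> tame f ->
  (@area R).-integrable A (EFin \o (fun q => f q * phi q)).
Proof.
move=> mA AQ [mf [M hf]].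
have h := @integrableZl _ _ R (@area R) A mA M _ (integrable_phi mA AQ).
apply: (@le_integrable _ _ R (@area R) _ mA _ _ _ _ h).
  apply/measurable_EFinP; apply: measurable_funM; first exact: measurable_funTS.
  exact: measurable_funS mphi.
move=> q Aq /=; rewrite lee_fin !normrM ler_wpM2r//.
by rewrite (le_trans (hf _ (AQ _ Aq)))// ler_norm.
Qed.

Lemma EFin_wint A f : measurable A -> A `<=` Q -> tame f ->
  (wint A f)%:E = (\int[area]_(q in A) (f q * phi q)%:E)%E.
Proof.
move=> mA AQ tf; rewrite /wint /Rintegral fineK//.
by apply: integrable_fin_num => //; exact: integrable_tame.
Qed.

Lemma wintD A f g : measurable A -> A `<=` Q -> tame f -> tame g ->
  wint A (fun q => f q + g q) = wint A f + wint A g.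
Proof.
move=> mA AQ tf tg; rewrite /wint -RintegralD//; try exact: integrable_tame.
by apply: eq_Rintegral => q _; rewrite mulrDl.
Qed.

Lemma wintZ A f c : measurable A -> A `<=` Q -> tame f ->
  wint A (fun q => c * f q) = c * wint A f.
Proof.
move=> mA AQ tf; rewrite /wint -RintegralZl//; last exact: integrable_tame.
by apply: eq_Rintegral => q _; rewrite mulrA.
Qed.

Lemma le_wint A f g : measurable A -> A `<=` Q -> tame f -> tame g ->
  (forall q, A q -> f q <= g q) -> wint A f <= wint A g.
Proof.
move=> mA AQ tf tg fg; apply: le_Rintegral => //; try exact: integrable_tame.
by move=> q Aq; rewrite ler_wpM2r ?fg// phi0//; exact: AQ.
Qed.

Lemma wint_ge0 A f : A `<=` Q -> (forall q, A q -> 0 <= f q) -> 0 <= wint A f.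
Proof.
by move=> AQ f0; apply: Rintegral_ge0 => q Aq; rewrite mulr_ge0 ?f0// phi0//; exact: AQ.
Qed.

Lemma wint1 A : wint A (fun=> 1) = Rintegral area A phi.
Proof. by apply: eq_Rintegral => q _; rewrite mul1r. Qed.

Lemma wintQ1 : wint Q (fun=> 1) = 1.
Proof. by rewrite wint1 /Rintegral phi1. Qed.

Lemma area_Q : area Q <> 0.
Proof.
move=> Q0; have e : (\int[area]_(q in Q) (phi q)%:E = 0)%E.
  by apply: (@null_set_integral _ _ R (@area R)) => //; exact/measurable_EFinP.
by move: e; rewrite phi1 => /eqP; rewrite onee_eq0.
Qed.

Lemma wint_null A f : measurable A -> A `<=` Q -> tame f ->
  wint A (fun=> 1) = 0 -> wint A f = 0.
Proof.
move=> mA AQ tf A0; have [mf [M hf]] := tf.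
have t1 := tame_cst 1; have tM c := tameM (tame_cst c) t1.
apply/eqP; rewrite eq_le; apply/andP; split.
  have := @le_wint A f (fun q => M * 1) mA AQ tf (tM M).
  rewrite wintZ// A0 mulr0; apply => q Aq; rewrite mulr1.
  by rewrite (le_trans (ler_norm _))// hf//; exact: AQ.
have := @le_wint A (fun q => - M * 1) f mA AQ (tM (- M)) tf.
rewrite wintZ// A0 mulr0; apply => q Aq; rewrite mulr1.
by rewrite lerNl (le_trans (ler_norm _))// normrN hf//; exact: AQ.
Qed.

Section Voronoi.
Variables (k : nat) (P : 'I_k -> R * R) (i0 : 'I_k).
Local Notation g := (min_sqdist P [set: 'I_k]%SET i0).

Lemma measurable_voronoi i : measurable (voronoi Q P i).
Proof.
have -> : voronoi Q P i = Q `&` \big[setI/setT]_(j | j != i)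
    [set q | sqdist q (P i) <= sqdist q (P j)].
  rewrite -bigcap_seq_cond; apply/seteqP; split=> q [Qq h]; split=> // j.
    by rewrite /= mem_index_enum; exact: h.
  by move=> ji; apply: h; rewrite /= mem_index_enum.
apply: measurableI => //; apply: bigsetI_measurable => j _.
rewrite -[X in measurable X]setTI.
by apply: measurable_fun_le => //; [exact: (tame_sqdist _).1|exact: (tame_sqdist _).1].
Qed.

Lemma voronoi_min i q : voronoi Q P i q -> g q = sqdist q (P i).
Proof.
move=> [Qq h]; have [j _ e] := min_sqdist_ex P q (finset.in_setT i0).
apply/eqP; rewrite eq_le min_sqdist_le ?inE//= e.
by have [->|ji] := eqVneq j i; [exact: lexx|exact: h].
Qed.

Lemma voronoi_cover q : Q q -> exists i, voronoi Q P i q.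
Proof.
move=> Qq; have [i _ e] := min_sqdist_ex P q (finset.in_setT i0).
by exists i; split=> // j _; rewrite -e; apply: min_sqdist_le; rewrite inE.
Qed.

Local Notation piece i := ((fun q => (sqdist q (P i) * phi q)%:E) \_ (voronoi Q P i)).

Lemma measurable_sqdist_phi p : measurable_fun Q (fun q => (sqdist q p * phi q)%:E).
Proof.
apply/measurable_EFinP; apply: measurable_funM => //.
by apply: measurable_funTS; exact: (tame_sqdist p).1.
Qed.

Lemma measurable_piece i : measurable_fun Q (piece i).
Proof.
apply/(measurable_restrict _ (measurable_voronoi i) mQ).
by apply: (measurable_funS mQ) (measurable_sqdist_phi (P i)) => q [].
Qed.

Lemma piece_ge0 i q : Q q -> (0 <= piece i q)%E.
Proof.
move=> Qq; rewrite patchE; case: ifP => _ //.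
by rewrite lee_fin mulr_ge0 ?sqdist_ge0// phi0.
Qed.

Lemma cost_piece : cost Q phi P = (\int[area]_(q in Q) (\sum_(i < k) piece i q))%E.
Proof.
rewrite /cost ge0_integral_sum//; [|exact: measurable_piece|exact: piece_ge0].
apply: eq_bigr => i _; rewrite -integral_mkcondr; congr (integral _ _ _).
by apply/seteqP; split=> q; [move=> v; split=> //; case: v|case].
Qed.

Lemma measurable_min_phi : measurable_fun Q (fun q => (g q * phi q)%:E).
Proof.
apply/measurable_EFinP; apply: measurable_funM => //.
by apply: measurable_funTS; exact: (tame_min_sqdist P _ i0).1.
Qed.

Lemma g_phi_ge0 q : Q q -> (0 <= (g q * phi q)%:E)%E.
Proof. by move=> Qq; rewrite lee_fin mulr_ge0 ?phi0// min_sqdist_ge0// inE. Qed.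

(** The closed Voronoi cells cover Q and may overlap, so the sum over cells can only overcount. This
    direction is the one wanted for P*. *)
Lemma cost_ge : ((wint Q g)%:E <= cost Q phi P)%E.
Proof.
rewrite EFin_wint//; last exact: tame_min_sqdist.
rewrite cost_piece; apply: ge0_le_integral => //.
- exact: g_phi_ge0.
- exact: measurable_min_phi.
- by apply: emeasurable_sum => i; exact: measurable_piece.
- move=> q Qq; have [i vi] := voronoi_cover Qq.
  rewrite (bigD1 i)//= patchE mem_set// -(voronoi_min vi) leeDl//.
  by apply: sume_ge0 => j _; exact: piece_ge0.
Qed.

Definition bisector (p q : R * R) : set (R * R) :=
  line (2 * (q.1 - p.1)) (2 * (q.2 - p.2)) (q.1 ^+ 2 - p.1 ^+ 2 + (q.2 ^+ 2 - p.2 ^+ 2)).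

(** Overlaps lie on bisectors of distinct points, which are null; coinciding points would have their
    common cell counted repeatedly. *)
Lemma cost_injective : injective P -> cost Q phi P = (wint Q g)%:E.
Proof.
move=> injP; rewrite EFin_wint//; last exact: tame_min_sqdist.
rewrite cost_piece; apply: ge0_ae_eq_integral => //.
- by apply: emeasurable_sum => i; exact: measurable_piece.
- exact: measurable_min_phi.
- by move=> q Qq; apply: sume_ge0 => j _; exact: piece_ge0.
- exact: g_phi_ge0.
pose N := \big[setU/set0]_(ij : 'I_k * 'I_k | ij.1 != ij.2) bisector (P ij.1) (P ij.2).
have N0 : (@area R).-negligible N.
  rewrite /N; elim/big_ind : _ => [|A B|[i j] /= ij]; first exact: negligible_set0.
    exact: negligibleU.
  apply/negligibleP; first exact: measurable_line.
  apply: area_line; apply: contra ij; rewrite xpair_eqE !mulf_eq0 pnatr_eq0/= !subr_eq0.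
  move=> /andP[/eqP e1 /eqP e2]; apply/eqP/injP.
  by move: e1 e2; case: (P i) => ? ?; case: (P j) => ? ? /= -> ->.
apply: (negligibleS _ N0) => q /=; apply: contra_notP => Nq Qq.
have [i vi] := voronoi_cover Qq.
rewrite (bigD1 i)//= big1 ?adde0; first by rewrite patchE mem_set// -(voronoi_min vi).
move=> j ji; rewrite patchE memNset// => vj; apply: Nq.
rewrite /N (bigD1 (j, i))//=; left.
have := voronoi_min vi; rewrite (voronoi_min vj) /bisector /line /sqdist /= => e.
lra.
Qed.

End Voronoi.
End Density.

(** * Moments of grid cells and clusterings of their centroids *)

Section Cells.
Context {R : realType}.
Variables (Q : set (R * R)) (phi : R * R -> R).
Hypotheses (bQ : exists M : R, forall q, Q q -> `|q.1| <= M /\ `|q.2| <= M)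
  (mQ : measurable Q) (mphi : measurable_fun Q phi) (phi0 : forall q, Q q -> 0 <= phi q)
  (phi1 : (\int[area]_(q in Q) (phi q)%:E = 1)%E).
Variables (a0 b0 eps : R) (n : nat) (idx : 'I_n -> int * int).
Hypotheses (eps0 : 0 < eps) (idx_inj : injective idx)
  (idx_cover : forall ij : int * int,
     (grid_square a0 b0 eps ij `&` Q !=set0) <-> exists t, idx t = ij).

Local Notation w := (weight Q phi a0 b0 eps idx).
Local Notation x := (centroid Q phi a0 b0 eps idx).
Local Notation cell := (cell Q a0 b0 eps idx).
Local Notation wint := (wint phi).
Local Notation tame := (tame Q).

Lemma measurable_cell j : measurable (cell j).
Proof. by apply: measurableI => //; exact: measurable_grid_square. Qed.

Lemma cell_sub j : cell j `<=` Q. Proof. by move=> q []. Qed.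

Local Hint Resolve measurable_cell cell_sub : core.

Lemma weightE j : w j = wint (cell j) (fun=> 1).
Proof. by rewrite wint1. Qed.

Lemma weight_ge0 j : 0 <= w j.
Proof. by rewrite weightE; apply: (@wint_ge0 R Q). Qed.

Lemma cover_cells : Q = \big[setU/set0]_(j <- index_enum 'I_n) cell j.
Proof.
rewrite -bigcup_seq; apply/seteqP; split=> [q Qq|q [j _ []//]].
have gs a z : a + (Num.floor ((z - a) / eps))%:~R * eps <= z
    < a + (Num.floor ((z - a) / eps) + 1)%:~R * eps.
  have /andP[] := floor_itv ((z - a) / eps).
  by rewrite ler_pdivlMr// ltr_pdivrMr// => h1 h2; apply/andP; split; lra.
pose ij := (Num.floor ((q.1 - a0) / eps), Num.floor ((q.2 - b0) / eps)).
have sq : grid_square a0 b0 eps ij q by split; exact: gs.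
have [j jE] : exists j, idx j = ij by apply/idx_cover; exists q.
by exists j; [rewrite /= mem_index_enum|split=> //; rewrite jE].
Qed.

Lemma sum_wint_cell f : tame f -> \sum_j wint (cell j) f = wint Q f.
Proof.
move=> tf; apply: EFin_inj; rewrite (EFin_wint mQ mphi phi0 phi1)//.
rewrite -sumEFin (eq_bigr (fun j => (\int[area]_(q in cell j) (f q * phi q)%:E)%E)); last first.
  by move=> j _; rewrite (EFin_wint mQ mphi phi0 phi1).
rewrite [in RHS]cover_cells; apply/esym.
apply: (@integral_bigsetU_EFin _ _ R (@area R)) => //.
- by move=> j; exact: measurable_cell.
- exact: index_enum_uniq.
- move=> i j _ _ [q [[h1 _] [h2 _]]]; apply: idx_inj; exact: grid_square_disjoint eps0 h1 h2.
- rewrite -cover_cells; apply/measurable_EFinP; apply: measurable_funM => //.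
  by apply: measurable_funTS; exact: tf.1.
Qed.

Lemma sum_weight : \sum_j w j = 1.
Proof.
rewrite (eq_bigr _ (fun j _ => weightE j)) sum_wint_cell ?(wintQ1 phi1)//.
exact: tame_cst.
Qed.

(** Valid also for weight 0, where [centroid] degenerates to the origin: the first moment is then 0
    as well. *)
Lemma moment_fst j : wint (cell j) fst = w j * (x j).1.
Proof.
have [w0|w0] := eqVneq (w j) 0; last by rewrite /= mulVKf.
rewrite w0 mul0r (wint_null mQ mphi phi0 phi1)//; first exact: tame_fst.
by rewrite -weightE.
Qed.

Lemma moment_snd j : wint (cell j) snd = w j * (x j).2.
Proof.
have [w0|w0] := eqVneq (w j) 0; last by rewrite /= mulVKf.
rewrite w0 mul0r (wint_null mQ mphi phi0 phi1)//; first exact: tame_snd.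
by rewrite -weightE.
Qed.

(** Parallel axis theorem: the two squared distances differ by an affine function of [q], whose
    integral depends only on the weight and the first moments. *)
Lemma wint_sqdist j c : wint (cell j) (sqdist^~ c) =
  w j * sqdist (x j) c + wint (cell j) (sqdist^~ (x j)).
Proof.
have aff (a b e : R) : tame (fun q => a * q.1 + (b * q.2 + e * 1)).
  apply: tameD; first by apply: tameM; [exact: tame_cst|exact: tame_fst].
  apply: tameD; first by apply: tameM; [exact: tame_cst|exact: tame_snd].
  by apply: tameM; exact: tame_cst.
pose a := 2 * ((x j).1 - c.1); pose b := 2 * ((x j).2 - c.2).
pose e := c.1 ^+ 2 - (x j).1 ^+ 2 + (c.2 ^+ 2 - (x j).2 ^+ 2).
have -> : sqdist^~ c = fun q => (a * q.1 + (b * q.2 + e * 1)) + sqdist q (x j).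
  by apply/funext => q; rewrite /sqdist /a /b /e; ring.
have tf := tame_fst bQ; have ts := tame_snd bQ; have tc (u : R) := @tame_cst R Q u.
rewrite (wintD mQ mphi phi0 phi1)//; last exact: tame_sqdist.
congr (_ + _).
rewrite (wintD mQ mphi phi0 phi1) ?(wintD mQ mphi phi0 phi1)//;
  try (by apply: tameM); last by apply: tameD; apply: tameM.
rewrite !(wintZ mQ mphi phi0 phi1)// moment_fst moment_snd -weightE /sqdist /a /b /e.
ring.
Qed.

(** The centroid minimises the inertia, and about the centre [m] of the square both coordinates are
    at most [eps / 2]. *)
Lemma wint_spread j : wint (cell j) (sqdist^~ (x j)) <= w j * (eps ^+ 2 / 2).
Proof.
pose m := (a0 + (idx j).1%:~R * eps + eps / 2, b0 + (idx j).2%:~R * eps + eps / 2).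
apply: (@le_trans _ _ (wint (cell j) (sqdist^~ m))).
  by rewrite [leRHS]wint_sqdist lerDr mulr_ge0 ?weight_ge0 ?sqdist_ge0.
rewrite mulrC weightE -(wintZ mQ mphi phi0 phi1)//; last exact: tame_cst.
apply: (le_wint mQ mphi phi0 phi1) => //; first exact: tame_sqdist.
  by apply: tameM; exact: tame_cst.
move=> q [[/andP[h1 h2] /andP[h3 h4]] _]; move: h1 h2 h3 h4.
rewrite !intrD !mulrDl !mul1r mulr1 /sqdist /m /=.
move: (_%:~R * eps) (_%:~R * eps) => u v h1 h2 h3 h4.
have aux z : - (eps / 2) <= z -> z <= eps / 2 -> z ^+ 2 <= eps ^+ 2 / 4.
  move=> z1 z2; rewrite -subr_ge0.
  have -> : eps ^+ 2 / 4 - z ^+ 2 = (eps / 2 - z) * (eps / 2 + z) by field.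
  by apply: mulr_ge0; lra.
have A : (q.1 - (a0 + v + eps / 2)) ^+ 2 <= eps ^+ 2 / 4 by apply: aux; lra.
have B : (q.2 - (b0 + u + eps / 2)) ^+ 2 <= eps ^+ 2 / 4 by apply: aux; lra.
move: A B; set y := _ ^+ 2; set z := (_ - _) ^+ 2; lra.
Qed.

Lemma cell_inertiaE j :
  cell_inertia Q phi a0 b0 eps idx j = (wint (cell j) (sqdist^~ (x j)))%:E.
Proof.
rewrite (EFin_wint mQ mphi phi0 phi1)//; last exact: tame_sqdist.
by apply: eq_integral => q _; rewrite mulrC.
Qed.


Lemma sqrD_weighted (al u v : R) : 1 < al ->
  (u + v) ^+ 2 <= al * u ^+ 2 + al / (al - 1) * v ^+ 2.
Proof.
move=> al1; have al0 : al - 1 != 0 by lra.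
rewrite -subr_ge0 [leRHS](_ : _ = ((al - 1) * u - v) ^+ 2 / (al - 1)); last by field.
by rewrite divr_ge0 ?sqr_ge0//; lra.
Qed.

Section Clusters.
Variables (k : nat) (P : 'I_k -> R * R) (i0 : 'I_k) (D : R).
Hypothesis D0 : 0 <= D.
Local Notation g := (min_sqdist P [set: 'I_k]%SET i0).
Local Notation G j := (wint (cell j) g).
Local Notation L := (Num.sqrt 2 * eps).

Let L0 : 0 < L. Proof. by rewrite mulr_gt0// sqrtr_gt0. Qed.
Let sqrt2n0 : Num.sqrt 2 != 0 :> R. Proof. by rewrite lt0r_neq0// sqrtr_gt0. Qed.
Let epsn0 : eps != 0. Proof. by rewrite lt0r_neq0. Qed.
Let tg : tame g. Proof. exact: tame_min_sqdist. Qed.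
Let tc (c : R) : tame (fun=> c). Proof. exact: tame_cst. Qed.

Ltac tame := by repeat (exact: tc || exact: tg || exact: tame_sqdist || apply: tameD || apply: tameM).

(** By the parallel axis theorem the centroid costs no more than the cell itself; then the distance
    from [q] to [c] exceeds that from [q] to P* by at most [r], and Young's inequality applies. *)
Lemma cell_approx_center j c r al : 1 < al -> (forall a, dist2 (P a) c <= r) ->
  w j * sqdist (x j) c <= al * G j + al / (al - 1) * r ^+ 2 * w j.
Proof.
move=> al1 hr; have r0 : 0 <= r by exact: le_trans (dist2_ge0 _ _) (hr i0).
apply: (@le_trans _ _ (wint (cell j) (sqdist^~ c))).
  rewrite wint_sqdist lerDl (@wint_ge0 R Q)// => q _; exact: sqdist_ge0.
rewrite weightE -!(wintZ mQ mphi phi0 phi1)// -(wintD mQ mphi phi0 phi1)//; try tame.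
apply: (le_wint mQ mphi phi0 phi1) => //; try tame.
move=> q _; rewrite mulr1; have [a _ ->] := min_sqdist_ex P q (finset.in_setT i0).
rewrite -!sqr_dist2; apply: le_trans (sqrD_weighted _ _ al1).
rewrite ler_sqr ?nnegrE ?addr_ge0 ?dist2_ge0//.
by apply: le_trans (ler_dist2D (P a) _ _) _; rewrite lerD2l.
Qed.

(* With [b] the distance from [q] to the centroid, [2 b <= 2 b ^ 2 / L + L / 2] makes the bound
   affine in [b ^ 2], whose mean on the cell is at most [L ^ 2 / 4]. *)
Lemma cell_approx j (Z : {set 'I_k}) z0 y al : z0 \in Z -> 0 <= y -> 1 < al ->
  (forall a, exists2 z, z \in Z & dist2 (P a) (P z) <= y) ->
  exists2 z, z \in Z &
    w j * sqdist (x j) (P z) <= al * G j + al / (al - 1) * (L / 2 + y) ^+ 2 * w j.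
Proof.
move=> z0Z y0 al1 hy; have [z zZ ez] := min_sqdist_ex P (x j) z0Z.
exists z => //; pose be := al / (al - 1).
have be0 : 0 <= be by rewrite divr_ge0//; lra.
pose b1 := be * (1 + 2 * y / L); pose b2 := be * (y ^+ 2 + y * L / 2).
have b10 : 0 <= b1 by rewrite mulr_ge0// addr_ge0// divr_ge0 ?(ltW L0)// mulr_ge0.
apply: (@le_trans _ _ (al * G j + (b1 * wint (cell j) (sqdist^~ (x j)) + b2 * w j))).
  rewrite weightE mulrC -!(wintZ mQ mphi phi0 phi1)//; try tame.
  rewrite -!(wintD mQ mphi phi0 phi1)//; try tame.
  apply: (le_wint mQ mphi phi0 phi1) => //; try tame.
  move=> q _; rewrite !mulr1; have [a _ ->] := min_sqdist_ex P q (finset.in_setT i0).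
  have [z' z'Z hz'] := hy a.
  rewrite -ez (le_trans (min_sqdist_le P _ _ z'Z))//.
  rewrite -[sqdist (x j) _]sqr_dist2 -[sqdist q (P a)]sqr_dist2 -[sqdist q (x j)]sqr_dist2.
  set u := dist2 q (P a); set b := dist2 q (x j).
  apply: (@le_trans _ _ ((u + (b + y)) ^+ 2)).
    rewrite ler_sqr ?nnegrE ?addr_ge0 ?dist2_ge0//.
    apply: le_trans (ler_dist2D q _ _) _; rewrite dist2C -/b.
    have := ler_dist2D (P a) q (P z'); rewrite -/u; lra.
  apply: le_trans (sqrD_weighted _ _ al1) _; rewrite lerD2l -/be.
  rewrite [leRHS](_ : _ = be * ((1 + 2 * y / L) * b ^+ 2 + (y ^+ 2 + y * L / 2))); last first.
    by rewrite /b1 /b2; ring.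
  rewrite ler_wpM2l// -subr_ge0.
  rewrite [leRHS](_ : _ = 2 * y / L * (b - L / 2) ^+ 2); last first.
    by field; rewrite ?sqrt2n0 ?epsn0.
  by rewrite mulr_ge0 ?sqr_ge0// divr_ge0 ?(ltW L0)// mulr_ge0.
rewrite lerD2l; have := ler_wpM2l b10 (wint_spread j).
have -> : eps ^+ 2 / 2 = L ^+ 2 / 4 by rewrite exprMn sqr_sqrtr//; field.
move=> h; apply: le_trans (lerD h (lexx _)) _.
rewrite le_eqVlt; apply/orP; left; apply/eqP; rewrite /b1 /b2 -/be.
by field; rewrite ?sqrt2n0 ?epsn0.
Qed.

(** The inequality is strict so that [rho = 0] yields no cells, which recovers the clusterings
    without singletons. *)
Definition near_cells (rho : R) : {set 'I_n} :=
  [set j | `[< exists q i, cell j q /\ dist2 q (P i) < rho >]]%SET.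

Lemma near_cells0 : near_cells 0 = finset.set0.
Proof.
apply/setP => j; rewrite !inE; apply/asboolP => -[q [i [_]]].
by rewrite ltNge dist2_ge0.
Qed.

(* Cells near P* form clusters of their own, at no cost; on the others the cost density is at
   least [rho ^ 2], which absorbs part of the discretisation error [B]. *)
Lemma clustering (Z : {set 'I_k}) (zc : 'I_k -> R * R) al B rho s E :
  0 <= rho -> 0 <= al -> al <= s -> 0 <= E -> B <= (s - al) * rho ^+ 2 + E ->
  (forall j, exists2 z, z \in Z & w j * sqdist (x j) (zc z) <= al * G j + B * w j) ->
  exists (cl : 'I_n -> 'I_n + 'I_k) ctr (U0 : {set 'I_n + 'I_k}),
    [/\ forall j, cl j \in U0, #|U0| = (#|near_cells rho| + #|Z|)%N &
      cluster_cost Q phi a0 b0 eps idx cl ctr <= s * wint Q g + E].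
Proof.
move=> rho0 al0 als E0 hB hz.
have [z hz'] : exists z : 'I_n -> 'I_k, forall j, z j \in Z /\
    w j * sqdist (x j) (zc (z j)) <= al * G j + B * w j.
  have h j : exists z, z \in Z /\ w j * sqdist (x j) (zc z) <= al * G j + B * w j.
    by have [z zZ h] := hz j; exists z.
  by have [z hz'] := boolp.choice h; exists z.
pose T := near_cells rho.
exists (fun j => if j \in T then inl j else inr (z j)).
exists (fun c => match c with inl j => x j | inr a => zc a end).
exists ((inl @: T) :|: (inr @: Z))%SET; split.
- move=> j; rewrite inE; case: ifP => jT; apply/orP.
    by left; exact: imset_f.
  by right; apply: imset_f; case: (hz' j).
- rewrite cardsU disjoint_setI0 ?cards0 ?subn0; last first.
    by apply/pred0P => c /=; apply/negP => /andP[/imsetP[? _ ->] /imsetP[]].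
  by rewrite !card_imset//; [move=> ? ? []|move=> ? ? []].
have G0 j : 0 <= G j.
  by apply: (@wint_ge0 R Q) => // q _; rewrite min_sqdist_ge0// inE.
rewrite /cluster_cost -(sum_wint_cell tg) -[E]mulr1 -sum_weight !mulr_sumr -big_split/=.
apply: ler_sum => j _; case: ifPn => jT.
  by rewrite sqdistxx mulr0 addr_ge0 ?mulr_ge0 ?weight_ge0// (le_trans al0).
have gj : rho ^+ 2 * w j <= G j.
  rewrite weightE -(wintZ mQ mphi phi0 phi1)//; apply: (le_wint mQ mphi phi0 phi1) => //; try tame.
  move=> q Cq; rewrite mulr1; have [a _ ->] := min_sqdist_ex P q (finset.in_setT i0).
  rewrite -sqr_dist2 ler_sqr ?nnegrE ?dist2_ge0// leNgt.
  apply: contra jT => h; rewrite inE; apply/asboolP; by exists q, a.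
case: (hz' j) => _ /le_trans -> //.
have := ler_wpM2r (weight_ge0 j) hB; have := ler_wpM2l _ gj; move=> /(_ (s - al)).
rewrite subr_ge0 => /(_ als) h1 h2; rewrite mulrDl in h2.
move: h1 h2; rewrite mulrA mulrBl; lra.
Qed.

Lemma card_near_cells (rho : R) : 0 <= rho -> linked P D ->
  #|near_cells rho|%:R * eps ^+ 2 <= (2 * (rho + eps)) ^+ 2 +
    k.-1%:R * (2 * (rho + eps) * (Num.sqrt 2 * D)).
Proof.
move=> rho0 PD; have := @count_near_squares R 'I_k P D rho a0 b0 eps i0 n idx (near_cells rho).
rewrite card_ord; apply=> // j; rewrite inE => /asboolP[q [i [[Cq _] h]]].
by exists q, i; split=> //; exact: ltW.
Qed.

Local Notation V := (seeding Q phi a0 b0 eps idx (seed_cost Q phi a0 b0 eps idx xpredT)).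

Lemma seeding_clusters_few al B s E t : k = t.+1 ->
  0 <= al -> al <= s -> 0 <= E -> B <= E ->
  (forall j, exists z, w j * sqdist (x j) (P z) <= al * G j + B * w j) ->
  V k [::] <= 5 * (1 + harm t) * (s * wint Q g + E).
Proof.
move=> kt al0 als E0 BE hz.
have [||cl [ctr [U0 [clU U0c h]]]] := @clustering [set: 'I_k]%SET P al B 0 s E (lexx 0) al0 als E0.
- by rewrite expr0n mulr0 add0r.
- by move=> j; have [z ?] := hz j; exists z => //; rewrite inE.
rewrite near_cells0 cards0 add0n cardsT card_ord in U0c.
rewrite {1}kt; apply: le_trans (seeding_approx_few weight_ge0 ctr clU sum_weight _) _.
  by rewrite U0c.
by rewrite ler_wpM2l// mulr_ge0// addr_ge0// harm_ge0.
Qed.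

Lemma seeding_clusters_many (Z : {set 'I_k}) (zc : 'I_k -> R * R) al B rho s E K t : k = t.+1 ->
  0 <= rho -> 0 <= al -> al <= s -> 0 <= E -> B <= (s - al) * rho ^+ 2 + E ->
  (forall j, exists2 z, z \in Z & w j * sqdist (x j) (zc z) <= al * G j + B * w j) ->
  (#|near_cells rho| + #|Z| <= K.+1)%N -> (K < t)%N ->
  V k [::] <= 5 * (1 + 10 * K%:R / (9 * (t - K)%:R)) * (s * wint Q g + E).
Proof.
move=> kt rho0 al0 als E0 BE hz TK Kt.
have [cl [ctr [U0 [clU U0c h]]]] := clustering rho0 al0 als E0 BE hz.
rewrite {1}kt.
apply: le_trans (seeding_approx_many weight_ge0 ctr clU sum_weight _ Kt) _.
  by rewrite U0c.
by rewrite ler_wpM2l// mulr_ge0// addr_ge0// divr_ge0// mulr_ge0.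
Qed.

End Clusters.
End Cells.

(** * From the expected coverage cost to the expected discrete cost *)

Section Sample.
Context {R : realType}.
Variables (Q : set (R * R)) (phi : R * R -> R).
Hypotheses (bQ : exists M : R, forall q, Q q -> `|q.1| <= M /\ `|q.2| <= M)
  (mQ : measurable Q) (mphi : measurable_fun Q phi) (phi0 : forall q, Q q -> 0 <= phi q)
  (phi1 : (\int[area]_(q in Q) (phi q)%:E = 1)%E).
Variables (a0 b0 eps : R) (n : nat) (idx : 'I_n -> int * int).
Hypotheses (eps0 : 0 < eps) (idx_inj : injective idx)
  (idx_cover : forall ij : int * int,
     (grid_square a0 b0 eps ij `&` Q !=set0) <-> exists t, idx t = ij).

Local Notation w := (weight Q phi a0 b0 eps idx).
Local Notation x := (centroid Q phi a0 b0 eps idx).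
Local Notation cell := (cell Q a0 b0 eps idx).
Local Notation wint := (wint phi).
Local Notation nearest := (nearest_sqdist Q phi a0 b0 eps idx).
Local Notation seq_prob := (seq_prob_aux Q phi a0 b0 eps idx).
Local Notation total := (seed_cost Q phi a0 b0 eps idx xpredT).
Local Notation seeding := (seeding Q phi a0 b0 eps idx).
Let w_ge0 : forall j, 0 <= w j. Proof. exact: weight_ge0. Qed.

Lemma seq_prob_ge0 ch s : 0 <= seq_prob ch s.
Proof.
elim: s ch => [|i s ih] ch /=; first exact: ler01.
by rewrite mulr_ge0// step_prob_ge0.
Qed.

(** After the first draw, a positive probability needs a positive distance to all chosen
    centroids. *)
Lemma seq_prob_uniq ch s : seq_prob ch s != 0 -> uniq (map x ch) -> uniq (map x (ch ++ s)).
Proof.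
elim: s ch => [|i s ih] ch; first by rewrite cats0.
move=> /=; rewrite mulf_eq0 negb_or => /andP[pi ps] uch.
rewrite -cat_rcons; apply: ih => //.
rewrite map_rcons rcons_uniq uch andbT.
case: ch pi {ps uch} => // c ch; rewrite /step_prob mulf_eq0 negb_or => /andP[+ _].
rewrite mulf_eq0 negb_or => /andP[_]; apply: contra => /mapP[j jch ->].
have := nearest_le Q phi a0 b0 eps idx (x j) jch; rewrite sqdistxx => h.
by rewrite eq_le h nearest_ge0.
Qed.

Definition inertia := \sum_j wint (cell j) (sqdist^~ (x j)).

Lemma inertia_ge0 : 0 <= inertia.
Proof.
by apply: sumr_ge0 => j _; apply: (@wint_ge0 R Q) => // q; [case|move=> _; exact: sqdist_ge0].
Qed.

Lemma sample_cost_le t (s : t.+1.-tuple 'I_n) : seq_prob [::] s != 0 ->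
  (cost Q phi (fun m => x (tnth s m)) <= (total s + inertia)%:E)%E.
Proof.
move=> /seq_prob_uniq /(_ isT) us.
set p := fun m => _.
have pinj : injective p.
  move=> i j; rewrite /p => /eqP; rewrite (tnth_nth (tnth s ord0)) [X in _ == x X](tnth_nth (tnth s ord0)).
  set y0 := tnth s ord0; rewrite -!(nth_map y0 (x y0)) ?size_tuple//.
  by rewrite nth_uniq ?size_map ?size_tuple// => /eqP/val_inj.
rewrite (cost_injective bQ mQ mphi phi0 phi1 ord0 pinj) lee_fin.
have tg := @tame_min_sqdist R Q bQ 'I_t.+1 p [set: 'I_t.+1]%SET ord0.
rewrite -(sum_wint_cell mQ mphi phi0 phi1 eps0 idx_inj idx_cover tg).
rewrite /seed_cost /inertia -big_split/=; apply: ler_sum => j _.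
have s0 : (s : seq _) != [::] by rewrite -size_eq0 size_tuple.
have [c cs ->] := nearest_ex Q phi a0 b0 eps idx (x j) s0.
rewrite -(wint_sqdist bQ mQ mphi phi0 phi1).
have mC : measurable (cell j) by apply: measurable_cell.
apply: (le_wint mQ mphi phi0 phi1) => //; [by move=> q []|exact: tame_sqdist|].
move=> q _; have [m ->] := tnthP _ _ cs.
by apply: (min_sqdist_le p); rewrite inE.
Qed.

Lemma expected_cost_le t : (expected_cost Q phi a0 b0 eps idx t.+1 <=
  (seeding total t.+1 [::] + inertia)%:E)%E.
Proof.
apply: (@le_trans _ _ (\sum_(s : t.+1.-tuple 'I_n)
    seq_prob [::] s * (total s + inertia))%:E).
  rewrite -sumEFin; apply: lee_sum => s _; rewrite /sample_prob.
  (* A sample of probability 0 may repeat a point and escape [sample_cost_le]; its term is 0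
     whatever its cost. *)
  have [->|ps] := eqVneq (seq_prob [::] s) 0; first by rewrite mul0e mul0r.
  by rewrite EFinM lee_wpmul2l ?lee_fin ?seq_prob_ge0// sample_cost_le.
rewrite lee_fin; under eq_bigr do rewrite mulrDr; rewrite big_split; apply: lerD.
  by rewrite -seedingE.
rewrite -mulr_suml -[leRHS]mul1r ler_wpM2r ?inertia_ge0//.
apply: le_trans (seeding1_le1 w_ge0 t.+1 [::]); rewrite -seedingE.
by under [leRHS]eq_bigr do rewrite mulr1.
Qed.

End Sample.

(** * Numerical estimates *)

Section Logarithm.
Context {R : realType}.

Lemma ln_ge_sub1V (x : R) : 0 < x -> 1 - x^-1 <= ln x.
Proof.
move=> x0; have xV : 0 < x^-1 by rewrite invr_gt0.
have h : -1 < x^-1 - 1 by lra.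
have := le_ln1Dx h; rewrite [1 + _]addrC subrK lnV ?posrE//; lra.
Qed.

(** The leading term of the series of [ln x] in [(x - 1) / (x + 1)]. After clearing the denominator,
    the difference has derivative [ln y + 1 / y - 1], which is nonnegative. *)
Lemma ln_ge_mobius (x : R) : 1 <= x -> 2 * (x - 1) <= (x + 1) * ln x.
Proof.
pose f (y : R) := (y + 1) * ln y - 2 * y.
have df (y : R) : 0 < y -> is_derive y 1 f (ln y + y^-1 - 1).
  move=> y0; have hl := is_derive1_ln y0.
  apply: is_derive_eq. rewrite /= !scaler1 addr0.
  by rewrite /GRing.scale /= !mulr1; field; rewrite lt0r_neq0.
move=> x1; have pos y : y \in `[1, x] -> 0 < y.
  by rewrite in_itv/= => /andP[y1 _]; lra.
have pos' y : y \in `]1, x[ -> 0 < y.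
  by rewrite in_itv/= => /andP[y1 _]; lra.
have cf : {within `[1, x], continuous f}.
  by apply: derivable_within_continuous => y /pos /df [].
have mono := @ger0_derive1_ndecr R f 1 x (fun y yx => let: DeriveDef d _ := df y (pos' y yx) in d) _ cf.
have : f 1 <= f x.
  apply: mono => // y /pos' y0; have := df y y0 => -[_ e].
  rewrite derive1E e; have := ln_ge_sub1V y0; lra.
rewrite /f ln1 mulr0 mulr1; lra.
Qed.

(** [16/15], [25/24] and [81/80] are close to 1 and involve only the primes 2, 3, 5. Their
    logarithms combine with coefficients (7, 5, 3), (11, 8, 5) and (16, 12, 7) to [ln 2], [ln 3] and
    [ln 5]; the fractions are rounded down. *)
Lemma ln_ge_prime : [/\ 97 / 140 <= ln 2 :> R, 56 / 51 <= ln 3 :> R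
  & 37 / 23 <= ln 5 :> R].
Proof.
have h (p q : R) : 0 < q -> q <= p -> 2 * (p - q) / (p + q) <= ln p - ln q.
  move=> q0 qp; have p0 : 0 < p by lra.
  rewrite -ln_div ?posrE// ler_pdivrMr; last by lra.
  have := @ln_ge_mobius (p / q); rewrite ler_pdivlMr// mul1r => /(_ qp).
  rewrite -(ler_pM2l q0) => hh.
  rewrite [leLHS](_ : _ = q * (2 * (p / q - 1))); last by field; rewrite lt0r_neq0.
  apply: le_trans hh _; rewrite le_eqVlt; apply/orP; left; apply/eqP.
  by field; rewrite lt0r_neq0.
have lX (y : R) m : 0 < y -> ln (y ^+ m) = m%:R * ln y.
  by move=> y0; rewrite lnXn// mulr_natl.
have p2 : 0 < 2 :> R by []. have p3 : 0 < 3 :> R by []. have p5 : 0 < 5 :> R by [].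
have l16 : ln (16 : R) = 4 * ln 2 by rewrite -(lX 2 4%N)//; congr ln; ring.
have l15 : ln (15 : R) = ln 3 + ln 5 by rewrite -lnM ?posrE//; congr ln; ring.
have l25 : ln (25 : R) = 2 * ln 5 by rewrite -(lX 5 2%N)//; congr ln; ring.
have l24 : ln (24 : R) = 3 * ln 2 + ln 3.
  by rewrite -(lX 2 3%N)// -lnM ?posrE ?exprn_gt0//; congr ln; ring.
have l81 : ln (81 : R) = 4 * ln 3 by rewrite -(lX 3 4%N)//; congr ln; ring.
have l80 : ln (80 : R) = 4 * ln 2 + ln 5.
  by rewrite -(lX 2 4%N)// -lnM ?posrE ?exprn_gt0//; congr ln; ring.
have h1 : 2 / 31 <= ln 16 - ln 15 :> R.
  by rewrite (_ : 2 / _ = 2 * (16 - 15) / (16 + 15)); [apply: h; lra|field].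
have h2 : 2 / 49 <= ln 25 - ln 24 :> R.
  by rewrite (_ : 2 / _ = 2 * (25 - 24) / (25 + 24)); [apply: h; lra|field].
have h3 : 2 / 161 <= ln 81 - ln 80 :> R.
  by rewrite (_ : 2 / _ = 2 * (81 - 80) / (81 + 80)); [apply: h; lra|field].
rewrite l16 l15 in h1; rewrite l25 l24 in h2; rewrite l81 l80 in h3.
split; lra.
Qed.

Lemma ln_nat_ge (a b c k : nat) : (2 ^ a * 3 ^ b * 5 ^ c <= k)%N ->
  a%:R * (97 / 140) + b%:R * (56 / 51) + c%:R * (37 / 23) <= ln (k%:R : R).
Proof.
have [h2 h3 h5] := ln_ge_prime => h.
have p2 : 0 < 2 ^+ a :> R by rewrite exprn_gt0.
have p3 : 0 < 3 ^+ b :> R by rewrite exprn_gt0.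
have p5 : 0 < 5 ^+ c :> R by rewrite exprn_gt0.
apply: (@le_trans _ _ (ln (2 ^+ a * 3 ^+ b * 5 ^+ c))).
  rewrite (lnM (mulr_gt0 p2 p3) p5) (lnM p2 p3) !lnXn//.
  rewrite -[ln 2 *+ _]mulr_natl -[ln 3 *+ _]mulr_natl -[ln 5 *+ _]mulr_natl.
  by apply: lerD; [apply: lerD|]; apply: ler_wpM2l.
rewrite -!natrX -!natrM ler_ln ?ler_nat// posrE ltr0n.
  by rewrite !muln_gt0 !expn_gt0.
by apply: leq_trans h; rewrite !muln_gt0 !expn_gt0.
Qed.

Lemma harm_le_ln (t : nat) : harm t <= 1 + ln (t.+1%:R : R).
Proof.
suff h : harm t.+1 <= 1 + ln (t.+1%:R : R).
  by apply: le_trans h; rewrite harmS lerDl invr_ge0.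
elim: t => [|t ih]; first by rewrite harmS /harm big_ord0 add0r invr1 ln1 addr0.
rewrite harmS; apply: le_trans (lerD ih (lexx _)) _.
have t0 : 0 < t.+1%:R :> R by rewrite ltr0n.
have t1 : 0 < t.+2%:R :> R by rewrite ltr0n.
have := @ln_ge_sub1V (t.+2%:R / t.+1%:R); rewrite divr_gt0// => /(_ isT).
rewrite ln_div ?posrE// invf_div (_ : 1 - _ = t.+2%:R^-1).
  by rewrite lerBrDl -addrA lerD2l.
have n0 := lt0r_neq0 t1; apply: (mulIf n0).
by rewrite mulrBl mul1r divfK// mulVf// -natrB// subSnn.
Qed.

End Logarithm.

(** * Numerical conditions for the ranges of k *)

Section Blocks.
Context {R : realType}.
Implicit Types lo z h al s q : R.

(* Here [lo <= ln k], [t = k - 1], lengths are measured in units of the diagonal of a grid square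
   (except [h], the radius of the neighbourhood of P*, in units of its side), [del] is the
   neighbour diameter and [z] the value of [del] below which the clustering of [mid_ok] is
   given up.  [s] is the admissible ratio of cluster cost to [H + 2 del], [al] the weight
   in Young's inequality, and [q] bounds the number of excess clusters divided by [t]. *)
Definition mid_ok lo z :=
  [/\ 0 <= lo, 0 <= z, (1 / 2 + 3 * z) ^+ 2 <= 2 * (216 / 185 * (lo + 2) - 1) * z &
  (1 / 2 + 3 * (5 / 24)) ^+ 2 <= 2 * (216 / 185 * (lo + 2) - 1) * (5 / 24)].

Definition center_ok lo z (tu : nat) := tu%:R ^+ 2 * z <= 8 * (8 / 5 * (lo + 2) - 1).

Definition rate_ok lo al s q :=
  [/\ 1 < al, al <= s, q < 1 & 5 * (9 * (1 - q) + 10 * q) * s <= 8 * (lo + 2) * (9 * (1 - q))].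

Definition near_center_ok lo z h al s q (tl tu : nat) :=
  [/\ 0 <= h, rate_ok lo al s q,
     al * (tu%:R * z / 2) ^+ 2 <= (al - 1) * ((s - al) * h ^+ 2 / 2 + 2 * s * z) &
     4 * (1 + h) ^+ 2 <= (q - 4 * (1 + h) * z) * tl%:R].

Definition near_dominating_ok lo z h al s q (tl : nat) :=
  [/\ 0 <= h, rate_ok lo al s q,
    al * (1 / 2) ^+ 2 <= (al - 1) * ((s - al) * h ^+ 2 / 2),
    al * (1 / 2 + 7 * z) ^+ 2 <= (al - 1) * ((s - al) * h ^+ 2 / 2 + 2 * s * z) &
    4 * (1 + h) ^+ 2 <= (q - 4 * (1 + h) * z - 8^-1) * tl%:R].

Lemma rate_okE lo al s q : rate_ok lo al s q ->
  5 * (1 + 10 * q / (9 * (1 - q))) * s <= 8 * (lo + 2).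
Proof.
move=> [_ _ q1 h].
have q1' : 0 < 9 * (1 - q) by rewrite mulr_gt0// subr_gt0.
rewrite -(ler_pM2r q1'); apply: le_trans h; rewrite le_eqVlt; apply/orP; left; apply/eqP.
have q2 : 1 - q != 0 by rewrite lt0r_neq0// subr_gt0.
by field.
Qed.

(** The name gives the range of [k], so the largest [t] is 34. [z] must be large enough for
    [mid_ok], roughly of order 1 / ln k, and small enough for [center_ok], of order ln k / k ^ 2;
    this window narrows as [k] grows. *)
Lemma block_16_35 : mid_ok (277 / 100) (9 / 200) /\ center_ok (277 / 100) (9 / 200) 34.
Proof. by rewrite /mid_ok /center_ok; do !split; lra. Qed.

Lemma block_36_44 : mid_ok (358 / 100) (1 / 30) /\ center_ok (358 / 100) (1 / 30) 43.
Proof. by rewrite /mid_ok /center_ok; do !split; lra. Qed.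

Lemma block_45_47 : mid_ok (38 / 10) (3 / 98) /\ center_ok (38 / 10) (3 / 98) 46.
Proof. by rewrite /mid_ok /center_ok; do !split; lra. Qed.

(** On this block the window for [z] is empty, so the cells near P* become clusters of their own,
    which leaves less error for the common centre. *)
Lemma block_48_50 : mid_ok (386 / 100) (3 / 100) /\
  near_center_ok (386 / 100) (3 / 100) (17 / 20) (11 / 5) (43 / 10) (77 / 150) 47 49.
Proof. by rewrite /mid_ok /near_center_ok /rate_ok; do !split; lra. Qed.

Lemma block_51_53 : mid_ok (391 / 100) (1 / 34) /\
  near_center_ok (391 / 100) (1 / 34) (9 / 10) (11 / 5) (87 / 20) (20 / 39) 50 52.
Proof. by rewrite /mid_ok /near_center_ok /rate_ok; do !split; lra. Qed.

Lemma block_54_57 : mid_ok (398 / 100) (2 / 69) /\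
  near_center_ok (398 / 100) (2 / 69) (19 / 20) (11 / 5) (35 / 8) (33 / 64) 53 56.
Proof. by rewrite /mid_ok /near_center_ok /rate_ok; do !split; lra. Qed.

Lemma block_58_59 : mid_ok (398 / 100) (2 / 69) /\
  near_center_ok (398 / 100) (2 / 69) 1 (11 / 5) (22 / 5) (20 / 39) 57 58.
Proof. by rewrite /mid_ok /near_center_ok /rate_ok; do !split; lra. Qed.

Lemma block_60_63 : mid_ok (409 / 100) (2 / 71) /\
  near_center_ok (409 / 100) (2 / 71) (21 / 20) (11 / 5) (22 / 5) (13 / 25) 59 62.
Proof. by rewrite /mid_ok /near_center_ok /rate_ok; do !split; lra. Qed.

(** Serves every [k >= 64]: a dominating set with [d = 7] keeps the distance to the centres
    independent of [k], while the radius [t * z / 2] of [near_center_ok] grows with it. *)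
Lemma block_64 : mid_ok (415 / 100) (1 / 36) /\
  near_dominating_ok (415 / 100) (1 / 36) (19 / 20) (21 / 10) (23 / 6) (7 / 12) 63.
Proof. by rewrite /mid_ok /near_dominating_ok /rate_ok; do !split; lra. Qed.

Lemma ln_block_ge lo (a b c tl t : nat) : (2 ^ a * 3 ^ b * 5 ^ c <= tl.+1)%N ->
  lo <= a%:R * (97 / 140) + b%:R * (56 / 51) + c%:R * (37 / 23) -> (tl <= t)%N ->
  lo <= ln t.+1%:R.
Proof.
by move=> abc hlo tlt; apply: le_trans hlo _; apply: ln_nat_ge; exact: leq_trans abc _.
Qed.

Lemma ln_blocks : [/\ (forall t, (15 <= t)%N -> 277 / 100 <= ln t.+1%:R :> R),
  (forall t, (35 <= t)%N -> 358 / 100 <= ln t.+1%:R :> R),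
  (forall t, (44 <= t)%N -> 38 / 10 <= ln t.+1%:R :> R),
  (forall t, (47 <= t)%N -> 386 / 100 <= ln t.+1%:R :> R) &
  [/\ (forall t, (50 <= t)%N -> 391 / 100 <= ln t.+1%:R :> R),
  (forall t, (53 <= t)%N -> 398 / 100 <= ln t.+1%:R :> R),
  (forall t, (59 <= t)%N -> 409 / 100 <= ln t.+1%:R :> R),
  (forall t, (63 <= t)%N -> 415 / 100 <= ln t.+1%:R :> R) &
  (forall t, (1 <= t)%N -> 69 / 100 <= ln t.+1%:R :> R) /\
  (forall t, (8 <= t)%N -> 219 / 100 <= ln t.+1%:R :> R)]].
Proof.
split; last split; last split; move=> t.
- by apply: (@ln_block_ge _ 4 0 0) => //; lra.
- by apply: (@ln_block_ge _ 2 2 0) => //; lra.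
- by apply: (@ln_block_ge _ 0 2 1) => //; lra.
- by apply: (@ln_block_ge _ 4 1 0) => //; lra.
- by apply: (@ln_block_ge _ 1 0 2) => //; lra.
- by apply: (@ln_block_ge _ 1 3 0) => //; lra.
- by apply: (@ln_block_ge _ 2 1 1) => //; lra.
- by apply: (@ln_block_ge _ 6 0 0) => //; lra.
- by apply: (@ln_block_ge _ 1 0 0) => //; lra.
- by apply: (@ln_block_ge _ 0 2 0) => //; lra.
Qed.

End Blocks.

(** * Choice of the clustering *)

Lemma excess_ratio (R : realType) (K t : nat) (q : R) : (0 < t)%N -> q < 1 ->
  K%:R <= q * t%:R ->
  (K < t)%N /\ 10 * K%:R / (9 * (t - K)%:R) <= 10 * q / (9 * (1 - q)).
Proof.
move=> t0 q1 Kq; have t1 : 0 < t%:R :> R by rewrite ltr0n.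
have Kt : (K < t)%N.
  rewrite -(ltr_nat R); apply: le_lt_trans Kq _; rewrite -[ltRHS]mul1r ltr_pM2r//.
split=> //; have tK : 0 < (t - K)%:R :> R by rewrite ltr0n subn_gt0.
have tKE : (t - K)%:R = t%:R - K%:R :> R by rewrite natrB// ltnW.
rewrite ler_pdivrMr ?mulr_gt0// mulrAC ler_pdivlMr ?mulr_gt0//; last by rewrite subr_gt0.
rewrite tKE; move: Kq; lra.
Qed.

Section Strategies.
Context {R : realType}.
Variables (Q : set (R * R)) (phi : R * R -> R).
Hypotheses (bQ : exists M : R, forall q, Q q -> `|q.1| <= M /\ `|q.2| <= M)
  (mQ : measurable Q) (mphi : measurable_fun Q phi) (phi0 : forall q, Q q -> 0 <= phi q)
  (phi1 : (\int[area]_(q in Q) (phi q)%:E = 1)%E).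
Variables (a0 b0 eps : R) (n : nat) (idx : 'I_n -> int * int).
Hypotheses (eps0 : 0 < eps) (idx_inj : injective idx)
  (idx_cover : forall ij : int * int,
     (grid_square a0 b0 eps ij `&` Q !=set0) <-> exists t, idx t = ij).
Variables (k t : nat) (P : 'I_k -> R * R) (i0 : 'I_k) (D del M : R).
Hypotheses (kt : k = t.+1) (D0 : 0 <= D) (PD : linked P D).

Local Notation w := (weight Q phi a0 b0 eps idx).
Local Notation x := (centroid Q phi a0 b0 eps idx).
Local Notation cell := (cell Q a0 b0 eps idx).
Local Notation wint := (wint phi).
Local Notation g := (min_sqdist P [set: 'I_k]%SET i0).
Local Notation G j := (wint (cell j) g).
Local Notation L := (Num.sqrt 2 * eps).
Hypothesis Ddel : D = del * L.

Local Notation V := (seeding Q phi a0 b0 eps idx (seed_cost Q phi a0 b0 eps idx xpredT)).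
Local Notation near := (near_cells Q a0 b0 eps idx P).

Definition seeding_bounded := V k [::] <= M * (wint Q g + 2 * L * D).

Let kt1 : k.-1 = t. Proof. by rewrite kt. Qed.
Let L0 : 0 < L. Proof. by rewrite mulr_gt0// sqrtr_gt0. Qed.
Let del0 : 0 <= del. Proof. by have := D0; rewrite Ddel pmulr_lge0. Qed.
Let H0 : 0 <= wint Q g + 2 * L * D.
Proof.
by rewrite addr_ge0 ?mulr_ge0// ?(ltW eps0)//; apply: (@wint_ge0 R Q) => // q _;
  rewrite min_sqdist_ge0// inE.
Qed.
Let LE : L ^+ 2 = 2 * eps ^+ 2. Proof. by rewrite exprMn sqr_sqrtr. Qed.
Let LLD (s : R) : s * (2 * L * D) = (2 * s * del) * L ^+ 2.
Proof. by rewrite Ddel; ring. Qed.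

Lemma divB_le (al c B : R) : 1 < al -> al * c <= (al - 1) * B ->
  al / (al - 1) * c <= B.
Proof.
by move=> al1 h; rewrite mulrAC ler_pdivrMr ?subr_gt0// [leRHS]mulrC.
Qed.

Lemma bounded_few s : 1 < s -> 1 / 4 <= 2 * (s - 1) * del ->
  5 * (1 + harm t) * s <= M -> seeding_bounded.
Proof.
move=> s1 hs hM; rewrite /seeding_bounded.
have E0 : 0 <= s * (2 * L * D) by rewrite !mulr_ge0// ?(ltW eps0)//; lra.
have s0 : 0 <= s by lra.
have BE : s / (s - 1) * (L / 2 + 0) ^+ 2 <= s * (2 * L * D).
  apply: divB_le => //; rewrite LLD addr0.
  have := ler_wpM2r (sqr_ge0 L) hs; have := ler_wpM2l s0 (ler_wpM2r (sqr_ge0 L) hs).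
  lra.
apply: le_trans (seeding_clusters_few (P := P) (i0 := i0) bQ mQ mphi phi0 phi1 eps0 idx_inj idx_cover kt s0 (lexx s)
  E0 BE _) _.
  move=> j; have [|z _ hz] := @cell_approx R Q phi bQ mQ mphi phi0 phi1 a0 b0 eps n idx eps0
    k P i0 j [set: 'I_k]%SET i0 0 s (finset.in_setT _) (lexx 0) s1; last by exists z.
  by move=> a; exists a; rewrite ?inE// dist2xx.
rewrite [leLHS](_ : _ = 5 * (1 + harm t) * s * (wint Q g + 2 * L * D)); last by ring.
by rewrite ler_wpM2r.
Qed.

(** With a single point there is no distance between centres, so [r = 0] and any weight above 1 is
    allowed; 3 gives 15, below 16 = 8 (ln 1 + 2). *)
Lemma bounded_one : t = 0%N -> 16 <= M -> seeding_bounded.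
Proof.
move=> t0 hM; rewrite /seeding_bounded.
have E0 : 0 <= 3 * (2 * L * D) by rewrite !mulr_ge0// ?(ltW eps0)//; lra.
have s0 : 0 <= 3 :> R by [].
have BE : (0 : R) <= 3 * (2 * L * D) by [].
apply: le_trans (seeding_clusters_few (P := P) (i0 := i0) bQ mQ mphi phi0 phi1 eps0 idx_inj idx_cover kt s0 (lexx _)
  E0 BE _) _.
  move=> j; exists i0; rewrite mul0r addr0.
  have := @cell_approx_center R Q phi bQ mQ mphi phi0 phi1 a0 b0 eps n idx k P i0 j (P i0) 0 3.
  rewrite expr0n mulr0 mul0r addr0; apply=> [|a]; first by lra.
  rewrite (_ : a = i0) ?dist2xx//; apply: val_inj.
  have lt1 (i : 'I_k) : (i < 1)%N by rewrite -t0 -[X in (_ < X)%N]kt.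
  by move: (lt1 a) (lt1 i0); rewrite /= !ltnS !leqn0 => /eqP -> /eqP ->.
rewrite t0 /harm big_ord0 addr0 mulr1.
rewrite [leLHS](_ : _ = 15 * (wint Q g + 2 * L * D)); last by ring.
by rewrite ler_wpM2r//; lra.
Qed.

(** The first draw hits one cluster, so [t] draws face [#|near| + #|Z| - 1] clusters; [q] bounds the
    ratio. [B] is the error in units of [L ^ 2]. *)
Lemma bounded_many (Z : {set 'I_k}) (zc : 'I_k -> R * R) al B h s q : (0 < t)%N ->
  0 <= h -> 1 < al -> al <= s -> al * B <= (al - 1) * ((s - al) * h ^+ 2 / 2 + 2 * s * del) ->
  (forall j, exists2 z, z \in Z &
    w j * sqdist (x j) (zc z) <= al * G j + al / (al - 1) * (B * L ^+ 2) * w j) ->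
  (0 < #|Z|)%N -> #|near (h * eps)|%:R + #|Z|.-1%:R <= q * t%:R -> q < 1 ->
  5 * (1 + 10 * q / (9 * (1 - q))) * s <= M -> seeding_bounded.
Proof.
move=> t0 h0 al1 als hB hz Z0 hq q1 hM; rewrite /seeding_bounded.
have s0 : 0 <= s by lra.
have E0 : 0 <= s * (2 * L * D) by rewrite !mulr_ge0// ?(ltW eps0).
have al0 : 0 <= al by lra.
pose K := (#|near (h * eps)| + #|Z|.-1)%N.
have [Kt hK] : (K < t)%N /\ 10 * K%:R / (9 * (t - K)%:R) <= 10 * q / (9 * (1 - q)).
  by apply: excess_ratio => //; rewrite natrD.
have rho0 : 0 <= h * eps by rewrite mulr_ge0// ltW.
have BE : al / (al - 1) * (B * L ^+ 2) <= (s - al) * (h * eps) ^+ 2 + s * (2 * L * D).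
  apply: divB_le => //; have := ler_wpM2r (sqr_ge0 L) hB.
  have -> : (h * eps) ^+ 2 = h ^+ 2 * L ^+ 2 / 2 by rewrite LE; field.
  by rewrite LLD; move: (L ^+ 2) => L2; lra.
have TK : (#|near (h * eps)| + #|Z| <= K.+1)%N by rewrite /K -addnS prednK.
apply: le_trans (seeding_clusters_many (P := P) (i0 := i0) bQ mQ mphi phi0 phi1 eps0 idx_inj idx_cover kt
  rho0 al0 als E0 BE hz TK Kt) _.
rewrite [leLHS](_ : _ = 5 * (1 + 10 * K%:R / (9 * (t - K)%:R)) * s * (wint Q g + 2 * L * D));
  last by ring.
rewrite ler_wpM2r//; apply: le_trans hM; rewrite ler_wpM2r// ler_wpM2l// lerD2l//.
Qed.

Lemma near_card h : 0 <= h -> #|near (h * eps)|%:R <=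
  4 * (1 + h) ^+ 2 + 4 * (1 + h) * (t%:R * del).
Proof.
move=> h0; have := card_near_cells Q a0 b0 eps0 idx_inj i0 D0 (mulr_ge0 h0 (ltW eps0)) PD.
move=> hh; rewrite -(ler_pM2r (exprn_gt0 2 eps0)); apply: le_trans hh _.
rewrite kt /= Ddel le_eqVlt; apply/orP; left; apply/eqP.
rewrite [LHS](_ : _ = (4 * (1 + h) ^+ 2 + 2 * (1 + h) * (t%:R * del) * Num.sqrt 2 ^+ 2) * eps ^+ 2).
  by rewrite sqr_sqrtr//; ring.
by ring.
Qed.

Lemma bounded_near_dominating d h al s q : (0 < t)%N -> 0 <= h -> 1 < al -> al <= s ->
  al * (1 / 2 + d%:R * del) ^+ 2 <= (al - 1) * ((s - al) * h ^+ 2 / 2 + 2 * s * del) ->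
  #|near (h * eps)|%:R + t%:R / d.+1%:R <= q * t%:R -> q < 1 ->
  5 * (1 + 10 * q / (9 * (1 - q))) * s <= M -> seeding_bounded.
Proof.
move=> t0 h0 al1 als hB hq q1 hM.
have [Z [i0Z Zc hZ]] := linked_dominating D0 PD i0 d.
apply: (@bounded_many Z P al _ h s q t0 h0 al1 als hB) => //.
- move=> j; have [|z zZ hz] := @cell_approx R Q phi bQ mQ mphi phi0 phi1 a0 b0 eps n idx eps0
    k P i0 j Z i0 (d%:R * D) al i0Z _ al1 hZ; first by rewrite mulr_ge0.
  exists z => //; apply: le_trans hz _; rewrite le_eqVlt; apply/orP; left; apply/eqP.
  by rewrite Ddel; congr (_ + _ * _ * _); ring.
- by rewrite card_gt0; apply/set0Pn; exists i0.
- apply: le_trans hq; rewrite lerD2l ler_pdivlMr// -natrM ler_nat.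
  move: Zc; rewrite card_ord kt1 => Zc; apply: leq_trans (leq_trunc_div t d.+1).
  by move: Zc; case: #|Z| => [//|m]; rewrite ltnS leq_mul2r => ->; rewrite orbT.
Qed.

Lemma bounded_near_center h al s q : (0 < t)%N -> 0 <= h -> 1 < al -> al <= s ->
  al * (t%:R * del / 2) ^+ 2 <= (al - 1) * ((s - al) * h ^+ 2 / 2 + 2 * s * del) ->
  #|near (h * eps)|%:R <= q * t%:R -> q < 1 ->
  5 * (1 + 10 * q / (9 * (1 - q))) * s <= M -> seeding_bounded.
Proof.
move=> t0 h0 al1 als hB hq q1 hM.
have [c hc] := linked_ball D0 PD i0.
rewrite card_ord kt1 in hc.
apply: (@bounded_many [set i0]%SET (fun=> c) al _ h s q t0 h0 al1 als hB) => //.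
- move=> j; exists i0; first by rewrite inE.
  have h1 := @cell_approx_center R Q phi bQ mQ mphi phi0 phi1 a0 b0 eps n idx k P i0 j c _ al al1 hc.
  apply: le_trans h1 _; rewrite le_eqVlt; apply/orP; left; apply/eqP.
  by rewrite Ddel; congr (_ + _ * _ * _); ring.
- by rewrite cards1.
- by rewrite cards1 addr0.
Qed.

Lemma bounded_dominating d s : (0 < t)%N -> (0 < d)%N -> 1 < s ->
  (1 / 2 + d%:R * del) ^+ 2 <= 2 * (s - 1) * del ->
  5 * (1 + 10 / (9 * d%:R)) * s <= M -> seeding_bounded.
Proof.
move=> t0 d0 s1 hB hM; have d1 : 0 < d%:R :> R by rewrite ltr0n.
have d2 : d.+1%:R = d%:R + 1 :> R by rewrite natr1.
(* The excess is at most [t / (d + 1)]; with [q = 1 / (d + 1)] the quotient [10 q / (9 (1 - q))] is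
   [10 / (9 d)]. *)
apply: (@bounded_near_dominating d 0 s s (d.+1%:R^-1)) => //.
- by rewrite subrr mul0r mul0r add0r; move: hB; set u := _ ^+ 2 => hB; have := ler_wpM2l (_ : 0 <= s) hB; lra.
- by rewrite mul0r near_cells0 cards0 add0r mulrC.
- by rewrite invf_lt1 ?ltr0n// ltr1n.
- rewrite (_ : 10 * _ / _ = 10 / (9 * d%:R))// d2; field.
  by rewrite !lt0r_neq0//=; lra.
Qed.

Lemma bounded_center s : (0 < t)%N -> 1 < s -> t%:R ^+ 2 * del <= 8 * (s - 1) ->
  5 * s <= M -> seeding_bounded.
Proof.
move=> t0 s1 hB hM.
apply: (@bounded_near_center 0 s s 0) => //.
- rewrite subrr mul0r mul0r add0r.
  have := ler_wpM2l (_ : 0 <= s * del / 4) hB => h1.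
  rewrite [leLHS](_ : _ = s * del / 4 * (t%:R ^+ 2 * del)); last by field.
  apply: le_trans (h1 _) _; first by rewrite divr_ge0// mulr_ge0//; lra.
  by rewrite le_eqVlt; apply/orP; left; apply/eqP; field.
- by rewrite mul0r near_cells0 cards0 mul0r.
- by rewrite mulr0 mul0r addr0 mulr1.
Qed.


Hypothesis ME : M = 8 * (ln k%:R + 2).

Lemma bounded_far : 5 / 24 <= del -> seeding_bounded.
Proof.
(* [8 / 5] is what [1 + harm t <= ln k + 2] leaves, and [5 / 24] solves
   [1 / 4 = 2 (8 / 5 - 1) del]. *)
move=> hd; apply: (@bounded_few (8 / 5)); [lra|lra|].
rewrite ME kt; have := @harm_le_ln R t; lra.
Qed.

(** For [d = 3] the factor is 5 (1 + 10 / 27) = 185 / 27, whence [216 / 185]. The condition on [del]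
    is a convex quadratic inequality, so its validity at [z] and [5 / 24] extends to the interval
    between. *)
Lemma bounded_mid lo z : (0 < t)%N -> lo <= ln k%:R -> mid_ok lo z ->
  z <= del -> del <= 5 / 24 -> seeding_bounded.
Proof.
move=> t0 hlo [lo0 z0 h1 h2] zd dy; apply: (@bounded_dominating 3 (216 / 185 * (lo + 2))) => //.
- lra.
- set s := 216 / 185 * (lo + 2) in h1 h2 *.
  rewrite -subr_ge0.
  have zy : 0 <= 5 / 24 - z by lra.
  have a1 : 0 <= (5 / 24 - del) * (2 * (s - 1) * z - (1 / 2 + 3 * z) ^+ 2).
    by rewrite mulr_ge0 ?subr_ge0.
  have a2 : 0 <= (del - z) * (2 * (s - 1) * (5 / 24) - (1 / 2 + 3 * (5 / 24)) ^+ 2).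
    by rewrite mulr_ge0 ?subr_ge0.
  have a3 : 0 <= 9 * ((del - z) * (5 / 24 - del)) * (5 / 24 - z).
    by apply: mulr_ge0 => //; apply: mulr_ge0 => //; apply: mulr_ge0; rewrite subr_ge0.
  have [ezy|nzy] := eqVneq (5 / 24 - z) 0.
    have -> : del = 5 / 24 by lra.
    by rewrite subr_ge0.
  have pzy : 0 < 5 / 24 - z by rewrite lt0r nzy.
  rewrite -(pmulr_lge0 _ pzy).
  rewrite [leRHS](_ : _ = (5 / 24 - del) * (2 * (s - 1) * z - (1 / 2 + 3 * z) ^+ 2) +
    (del - z) * (2 * (s - 1) * (5 / 24) - (1 / 2 + 3 * (5 / 24)) ^+ 2) +
    9 * ((del - z) * (5 / 24 - del)) * (5 / 24 - z)); last by field.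
  by rewrite !addr_ge0.
- by rewrite ME (_ : 5 * (1 + 10 / (9 * 3)) = 185 / 27 :> R); [lra|field].
Qed.

Lemma bounded_close lo z (tu : nat) : (0 < t)%N -> 0 <= lo -> lo <= ln k%:R -> (t <= tu)%N ->
  del <= z -> center_ok lo z tu -> seeding_bounded.
Proof.
move=> t0 lo0 hlo ttu dz h; apply: (@bounded_center (8 / 5 * (lo + 2))) => //.
- lra.
- apply: le_trans h; apply: ler_pM; rewrite ?exprn_ge0//.
  by rewrite lerXn2r ?nnegrE// ler_nat.
- by rewrite ME; lra.
Qed.

(** Both sides are affine in [del], and the inequality holds at 0 and at [z]. *)
Lemma chord_le (A C c z : R) : 0 <= c -> A * z <= c + C * z -> del <= z -> A * del <= c + C * del.
Proof.
move=> c0 hz dz; have [AC|CA] := leP A C.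
  by apply: le_trans (ler_wpM2r del0 AC) _; rewrite lerDr.
have := ler_wpM2l (_ : 0 <= A - C) dz; rewrite subr_ge0 => /(_ (ltW CA)).
rewrite !mulrBl => h; move: h hz; set u := A * _; set v := C * _; set u' := A * _; set v' := C * _.
move=> h hz; rewrite -lerBlDr; apply: le_trans h _; by rewrite lerBlDr.
Qed.

(** [e] reserves the share of a dominating set, [1 / 8] for [d = 7] and 0 for a single centre. *)
Lemma near_card_le z h (tl : nat) e q : (tl <= t)%N -> 0 <= h -> del <= z ->
  4 * (1 + h) ^+ 2 <= (q - 4 * (1 + h) * z - e) * tl%:R ->
  #|near (h * eps)|%:R + e * t%:R <= q * t%:R.
Proof.
move=> tlt h0 dz hq; have tltR : tl%:R <= t%:R :> R by rewrite ler_nat.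
have h1 : 0 < 4 * (1 + h) ^+ 2 by rewrite mulr_gt0// exprn_gt0// ltr_wpDr.
have qz : 0 <= q - 4 * (1 + h) * z - e.
  rewrite leNgt; apply/negP => qz; have := ler_wnM2l (ltW qz) (ler0n R tl).
  by rewrite mulr0 => /(le_trans hq); rewrite leNgt h1.
apply: le_trans (lerD (near_card h0) (lexx _)) _.
have h3 : 4 * (1 + h) * (t%:R * del) <= 4 * (1 + h) * (t%:R * z).
  by rewrite ler_wpM2l ?mulr_ge0 ?addr_ge0// ler_wpM2l.
have h4 := le_trans hq (ler_wpM2l qz tltR).
apply: le_trans (lerD (lerD h4 h3) (lexx _)) _.
by rewrite le_eqVlt; apply/orP; left; apply/eqP; ring.
Qed.

Lemma bounded_close_near_center lo z h al s q (tl tu : nat) : (0 < t)%N -> lo <= ln k%:R ->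
  (tl <= t <= tu)%N -> 0 <= z -> del <= z -> near_center_ok lo z h al s q tl tu ->
  seeding_bounded.
Proof.
move=> t0 hlo /andP[tlt ttu] z0 dz [h0 rate hz hq].
have [al1 als q1 _] := rate; have al0 : 0 <= al by apply: ltW; apply: lt_trans al1.
apply: (@bounded_near_center h al s q) => //.
- have c0 : 0 <= (al - 1) * ((s - al) * h ^+ 2 / 2).
    by rewrite !mulr_ge0 ?sqr_ge0 ?subr_ge0// ltW.
  (* Replacing [del ^ 2] by [z * del] makes the condition affine, so that [chord_le] reduces it to
     [del = z]. *)
  have h1 : al * (t%:R * del / 2) ^+ 2 <= (al * (tu%:R / 2) ^+ 2 * z) * del.
    rewrite [leLHS](_ : _ = al * ((t%:R / 2) ^+ 2 * (del * del))); last by ring.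
    rewrite [leRHS](_ : _ = al * ((tu%:R / 2) ^+ 2 * (z * del))); last by ring.
    rewrite ler_wpM2l// ler_pM ?sqr_ge0 ?mulr_ge0//; last by rewrite ler_wpM2r.
    by rewrite lerXn2r ?nnegrE ?divr_ge0// ler_pM2r// ler_nat.
  apply: le_trans h1 _.
  rewrite (_ : (al - 1) * _ = (al - 1) * ((s - al) * h ^+ 2 / 2) + (al - 1) * (2 * s) * del);
    last by ring.
  apply: (@chord_le _ _ _ z) => //.
  rewrite [leLHS](_ : _ = al * (tu%:R * z / 2) ^+ 2); last by ring.
  by apply: le_trans hz _; rewrite le_eqVlt; apply/orP; left; apply/eqP; ring.
- by have := @near_card_le z h tl 0 q tlt h0 dz; rewrite mul0r addr0 subr0; apply.
- by apply: le_trans (rate_okE rate) _; rewrite ME ler_wpM2l// lerD2r.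
Qed.

Lemma bounded_close_near_dominating lo z h al s q (tl : nat) : (0 < t)%N -> lo <= ln k%:R ->
  (tl <= t)%N -> 0 <= z -> del <= z -> near_dominating_ok lo z h al s q tl -> seeding_bounded.
Proof.
move=> t0 hlo tlt z0 dz [h0 rate hz0 hz hq].
have [al1 als q1 _] := rate; have al0 : 0 <= al by apply: ltW; apply: lt_trans al1.
apply: (@bounded_near_dominating 7 h al s q) => //.
- have h1 : al * (1 / 2 + 7 * del) ^+ 2 <= al * (1 / 4 + (7 + 49 * z) * del).
    rewrite ler_wpM2l// -subr_ge0 [leRHS](_ : _ = 49 * (del * (z - del))); last by field.
    by rewrite !mulr_ge0// subr_ge0.
  apply: le_trans h1 _; set c := (al - 1) * ((s - al) * h ^+ 2 / 2) in hz0 *.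
  rewrite [leLHS](_ : _ = al * (1 / 2) ^+ 2 + al * (7 + 49 * z) * del); last by field.
  rewrite (_ : (al - 1) * _ = c + (al - 1) * (2 * s) * del); last by rewrite /c; ring.
  rewrite -lerBrDl (addrAC c); apply: (@chord_le _ _ _ z) => //; first by rewrite subr_ge0.
  rewrite (addrAC c) lerBrDl [leLHS](_ : _ = al * (1 / 2 + 7 * z) ^+ 2); last by field.
  by apply: le_trans hz _; rewrite /c le_eqVlt; apply/orP; left; apply/eqP; ring.
- by rewrite [t%:R / _]mulrC; apply: near_card_le hq.
- by apply: le_trans (rate_okE rate) _; rewrite ME ler_wpM2l// lerD2r.
Qed.

Lemma bounded_block (lo z : R) (tu : nat) : (0 < t)%N -> del <= 5 / 24 -> lo <= ln k%:R ->
  (t <= tu)%N -> mid_ok lo z /\ center_ok lo z tu -> seeding_bounded.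
Proof.
move=> t0 d1 hk ttu [h1 h2]; have [zd|/ltW dz] := leP z del; first exact: bounded_mid h1 zd d1.
by have [lo0 _ _ _] := h1; exact: bounded_close dz h2.
Qed.

Lemma bounded_block_near (lo z h al s q : R) (tl tu : nat) : (0 < t)%N -> del <= 5 / 24 ->
  lo <= ln k%:R -> (tl <= t <= tu)%N -> mid_ok lo z /\ near_center_ok lo z h al s q tl tu ->
  seeding_bounded.
Proof.
move=> t0 d1 hk tt [h1 h2]; have [zd|/ltW dz] := leP z del; first exact: bounded_mid h1 zd d1.
by have [_ z0 _ _] := h1; exact: bounded_close_near_center tt z0 dz h2.
Qed.

Lemma seeding_bounded_all : seeding_bounded.
Proof.
case: (posnP t) => [t0|t0].
  by apply: bounded_one => //; rewrite ME kt t0 ln1 add0r -natrM.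
have [d1|/ltW d1] := leP (5 / 24) del; first exact: bounded_far.
have [l16 l36 l45 l48 [l51 l54 l60 l64 [l2 l9]]] := @ln_blocks R.
have lk lo (H : lo <= ln t.+1%:R :> R) : lo <= ln k%:R by rewrite kt.
(* For [k <= 15] a single centre works all the way up to [del = 5 / 24], without an intermediate
   clustering. *)
have [t7|t7] := leqP t 7.
  have [lo0 c] : (0 : R) <= 69 / 100 /\ center_ok (69 / 100) (5 / 24 : R) 7.
    by rewrite /center_ok; split; lra.
  exact: bounded_close lo0 (lk _ (l2 _ t0)) t7 d1 c.
have [t14|t14] := leqP t 14.
  have [lo0 c] : (0 : R) <= 219 / 100 /\ center_ok (219 / 100) (5 / 24 : R) 14.
    by rewrite /center_ok; split; lra.
  exact: bounded_close lo0 (lk _ (l9 _ t7)) t14 d1 c.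
have [t34|t34] := leqP t 34; first exact: bounded_block (lk _ (l16 _ t14)) t34 block_16_35.
have [t43|t43] := leqP t 43; first exact: bounded_block (lk _ (l36 _ t34)) t43 block_36_44.
have [t46|t46] := leqP t 46; first exact: bounded_block (lk _ (l45 _ t43)) t46 block_45_47.
have tt (tl tu : nat) (H : (tl <= t)%N) (H' : (t <= tu)%N) : (tl <= t <= tu)%N by rewrite H.
have [t49|t49] := leqP t 49.
  exact: bounded_block_near (lk _ (l48 _ t46)) (tt _ _ t46 t49) block_48_50.
have [t52|t52] := leqP t 52.
  exact: bounded_block_near (lk _ (l51 _ t49)) (tt _ _ t49 t52) block_51_53.
have [t56|t56] := leqP t 56.
  exact: bounded_block_near (lk _ (l54 _ t52)) (tt _ _ t52 t56) block_54_57.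
have [t58|t58] := leqP t 58.
  have t53 : (53 <= t)%N by apply: leq_trans t56.
  exact: bounded_block_near (lk _ (l54 _ t53)) (tt _ _ t56 t58) block_58_59.
have [t62|t62] := leqP t 62.
  exact: bounded_block_near (lk _ (l60 _ t58)) (tt _ _ t58 t62) block_60_63.
have [h1 h2] := @block_64 R; have hk := lk _ (l64 _ t62).
have [zd|/ltW dz] := leP (1 / 36) del; first exact: bounded_mid h1 zd d1.
by have [_ z0 _ _] := h1; exact: bounded_close_near_dominating t62 z0 dz h2.
Qed.

End Strategies.

Lemma neighbor_diam_ge0 (R : realType) (Q : set (R * R)) (k : nat) (P : 'I_k -> R * R) :
  0 <= neighbor_diam Q P.
Proof. exact: bigmax_ge_id. Qed.

Lemma neighbor_diam_ge (R : realType) (Q : set (R * R)) (k : nat) (P : 'I_k -> R * R) a b :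
  a != b -> voronoi_neighbors Q P a b -> dist2 (P a) (P b) <= neighbor_diam Q P.
Proof.
move=> ab nab; apply: (le_trans _ (le_bigmax _ _ a)).
by apply: le_bigmax_cond; rewrite ab; apply/asboolP.
Qed.

Theorem theorem1 (R : realType) (Q : set (R * R)) (phi : R * R -> R)
  (k : nat) (Pstar : 'I_k -> R * R) (eps a0 b0 : R) (n : nat)
  (idx : 'I_n -> int * int) :
  bounded_convex Q -> measurable Q ->
  measurable_fun Q phi -> (forall q, Q q -> 0 <= phi q) ->
  (\int[area]_(q in Q) (phi q)%:E = 1)%E ->
  (0 < k)%N ->
  (forall i, Q (Pstar i)) ->
  (forall P : 'I_k -> R * R, (forall i, Q (P i)) ->
     (cost Q phi Pstar <= cost Q phi P)%E) ->
  0 < eps ->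
  injective idx ->
  (forall ij : int * int,
     (grid_square a0 b0 eps ij `&` Q !=set0) <-> exists t, idx t = ij) ->
  (* the sampling can produce k points: k distinct centroids of cells of
     positive weight exist *)
  (exists s : k.-tuple 'I_n,
     uniq [seq centroid Q phi a0 b0 eps idx i | i <- s] /\
     forall i, i \in s -> 0 < weight Q phi a0 b0 eps idx i) ->
  (expected_cost Q phi a0 b0 eps idx k <=
     (8 * (ln k%:R + 2))%:E * cost Q phi Pstar
     + (16 * Num.sqrt 2 * (ln k%:R + 2) * neighbor_diam Q Pstar * eps)%:E
     + \sum_(i < n) cell_inertia Q phi a0 b0 eps idx i)%E.
Proof.
move=> [bQ convQ] mQ mphi phi0 phi1 k0 QP _ eps0 idx_inj idx_cover _.
set D := neighbor_diam Q Pstar; have D0 : 0 <= D by exact: neighbor_diam_ge0.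
have aQ := area_Q mQ mphi phi1.
have PD : linked Pstar D := voronoi_linked D0 mQ aQ convQ QP (@neighbor_diam_ge R Q k Pstar).
case: k k0 Pstar QP D D0 PD => // t _ P QP D D0 PD.
set M := 8 * (ln t.+1%:R + 2).
have L0 : Num.sqrt 2 * eps != 0 by rewrite lt0r_neq0// mulr_gt0// sqrtr_gt0.
have Ddel : D = D / (Num.sqrt 2 * eps) * (Num.sqrt 2 * eps) by rewrite divfK.
have hV := seeding_bounded_all (M := M) bQ mQ mphi phi0 phi1 eps0 idx_inj idx_cover
  ord0 erefl D0 PD Ddel erefl.
have lnk : 0 <= ln t.+1%:R :> R by rewrite ln_ge0// ler1n.
have M0 : 0 <= M by rewrite mulr_ge0// addr_ge0.
apply: le_trans (expected_cost_le bQ mQ mphi phi0 phi1 eps0 idx_inj idx_cover t) _.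
rewrite EFinD; apply: leeD; last first.
  rewrite -sumEFin; apply: lee_sum => j _.
  by rewrite (cell_inertiaE bQ mQ mphi phi0 phi1).
apply: (@le_trans _ _ (M * (wint phi Q (min_sqdist P [set: 'I_t.+1]%SET ord0) +
    2 * (Num.sqrt 2 * eps) * D))%:E); first by rewrite lee_fin.
rewrite mulrDr EFinD; apply: leeD.
  by rewrite EFinM lee_wpmul2l ?lee_fin//; apply: cost_ge.
by rewrite lee_fin le_eqVlt; apply/orP; left; apply/eqP; rewrite /M; ring.
Qed.
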